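(* Let $\mu\in M(\mathbb{R})$, let $\widehat\mu$ be its Fourier transform, and let $z$ be a non-real complex number. Then the principal value integral below exists and $$\frac{i}{\sqrt{2\pi}}\ \mathrm{V.P.}\int_{-\infty}^{\infty}\frac{\widehat\mu(\lambda)}{\lambda+z}\,d\lambda=F(z),$$ where $F$ is the Carleman transform of the measure $\mu$.
   Context: $M(\mathbb{R})$ is the set of finite complex Borel measures on $\mathbb{R}$, and $\widehat\mu(x)=\frac{1}{\sqrt{2\pi}}\int_{-\infty}^{\infty}e^{-ixt}\,d\mu(t)$. For non-real $z$, $\mathrm{V.P.}\int_{-\infty}^\infty(\cdot)\,d\lambda=\lim_{N\to\infty}\int_{-N}^{N}(\cdot)\,d\lambda$. The Carleman transform $F=(F_+,F_-)$ of $\mu$ is defined by $$F(z)=F_+(z)=\int_{[0,\infty)}e^{itz}\,d\mu_0(t)\ \ (\operatorname{Im}z>0),\qquad F(z)=F_-(z)=-\int_{(-\infty,0]}e^{itz}\,d\mu_0(t)\ \ (\operatorname{Im}z<0),$$ where $\mu_0=\mu-\tfrac12\mu(\{0\})\delta$ and $\delta$ is the Dirac measure at $0$. *)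

(* Defs.v *)
From HB Require Import structures.
From mathcomp Require Import all_boot all_order all_algebra.
From mathcomp Require Import complex.
From mathcomp Require Import all_classical all_reals all_analysis.

Set Implicit Arguments.
Unset Strict Implicit.
Unset Printing Implicit Defensive.

Import Order.TTheory GRing.Theory Num.Theory.
Import numFieldNormedType.Exports.

Local Open Scope classical_set_scope.
Local Open Scope ring_scope.
Local Open Scope complex_scope.

(* The complex numbers are R[i]. This makes their usual (norm) topology
   available by inference on the concrete type R[i]. *)
HB.instance Definition _ (R : rcfType) := NormedModule.copy R[i] R[i]^o.

Section complex_limits.
Context (R : realType).
Implicit Types (u : R[i]^nat) (l : R[i]).

Lemma cvg_complex_Re u l : u @ \oo --> l ->
  complex.Re (u n) @[n --> \oo] --> complex.Re l.
Proof.
move=> /cvgrPdist_lt ul; apply/cvgrPdist_lt => e e0.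
have := ul e%:C; rewrite ltcR => /(_ e0).
apply: filterS => n h; rewrite -raddfB -ltcR.
exact: le_lt_trans (normc_ge_Re _) h.
Qed.

Lemma cvg_complex_Im u l : u @ \oo --> l ->
  complex.Im (u n) @[n --> \oo] --> complex.Im l.
Proof.
move=> ul; have ImE (z : R[i]) : complex.Im z = complex.Re (- 'i%C * z).
  by case: z => a b /=; rewrite oppr0 mul0r sub0r mulN1r opprK.
under eq_fun do rewrite ImE.
by rewrite ImE; apply: cvg_complex_Re; apply: cvgMr.
Qed.

Lemma cvg_real_complex (v : R^nat) (r : R) : v @ \oo --> r ->
  (v n)%:C @[n --> \oo] --> r%:C.
Proof.
move=> /cvgrPdist_lt vr; apply/cvgrPdist_lt => e e0.
have eE : e = (complex.Re e)%:C by rewrite RRe_real// gtr0_real.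
have := vr (complex.Re e); rewrite -ltcR -eE => /(_ e0).
apply: filterS => n; rewrite -ltcR -eE => h.
by rewrite -rmorphB/= normc_def/= expr0n addr0 sqrtr_sqr.
Qed.

End complex_limits.

(* Complex measures in the textbook sense: every value is a (finite) complex
   number, and only values on measurable sets are constrained. *)
Record complex_measure d (T : measurableType d) (R : realType) :=
  ComplexMeasure {
    cmeas :> set T -> R[i];
    cmeas0 : cmeas set0 = 0;
    cmeas_sigma_additive : forall F : (set T)^nat,
      (forall n, measurable (F n)) -> trivIset setT F ->
      \sum_(0 <= k < n) cmeas (F k) @[n --> \oo] --> cmeas (\bigcup_n F n)
  }.

Section complex_measure_ops.
Context d (T : measurableType d) (R : realType).
Implicit Types mu nu : complex_measure T R.

Program Definition cmeas_add mu nu : complex_measure T R :=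
  @ComplexMeasure _ T R (fun A => mu A + nu A) _ _.
Next Obligation. by move=> mu nu /=; rewrite !cmeas0 addr0. Qed.
Next Obligation.
move=> mu nu F mF tF /=.
under eq_fun do rewrite big_split/=.
by apply: cvgD; apply: cmeas_sigma_additive.
Qed.

Program Definition cmeas_scale (c : R[i]) mu : complex_measure T R :=
  @ComplexMeasure _ T R (fun A => c * mu A) _ _.
Next Obligation. by move=> c mu /=; rewrite cmeas0 mulr0. Qed.
Next Obligation.
move=> c mu F mF tF /=.
under eq_fun do rewrite -mulr_sumr.
by apply: cvgMr; apply: cmeas_sigma_additive.
Qed.

Program Definition cmeas_dirac (a : T) : complex_measure T R :=
  @ComplexMeasure _ T R (fun A => (fine (\d_a A))%:C) _ _.
Next Obligation. by move=> a /=; rewrite indic0. Qed.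
Next Obligation.
move=> a F mF tF /=.
under eq_fun do rewrite -rmorph_sum/=.
apply: cvg_real_complex.
have := @measure_semi_sigma_additive _ _ R (dirac a) F mF tF
  (bigcup_measurable (fun i _ => mF i)).
move=> /fine_cvgP[_]; apply: cvg_trans; apply: near_eq_cvg.
by apply: nearW => n /=; rewrite /dirac sumEFin.
Qed.

End complex_measure_ops.

Section complex_measure_parts.
Context d (T : measurableType d) (R : realType).
Variable mu : complex_measure T R.

Definition cmeas_Re (A : set T) : \bar R := (complex.Re (mu A))%:E.
Definition cmeas_Im (A : set T) : \bar R := (complex.Im (mu A))%:E.

Let cmeas_Re0 : cmeas_Re set0 = 0%E.
Proof. by rewrite /cmeas_Re cmeas0. Qed.

Let cmeas_Re_sigma_additive : semi_sigma_additive cmeas_Re.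
Proof.
move=> F mF tF _; rewrite /cmeas_Re.
under eq_fun do rewrite sumEFin.
apply: cvg_EFin; first exact: nearW.
have := cvg_complex_Re (@cmeas_sigma_additive _ _ _ mu _ mF tF).
by under eq_fun do rewrite raddf_sum.
Qed.

HB.instance Definition _ := isCharge.Build _ _ _ cmeas_Re
  cmeas_Re0 (fun _ _ => erefl) cmeas_Re_sigma_additive.

Let cmeas_Im0 : cmeas_Im set0 = 0%E.
Proof. by rewrite /cmeas_Im cmeas0. Qed.

Let cmeas_Im_sigma_additive : semi_sigma_additive cmeas_Im.
Proof.
move=> F mF tF _; rewrite /cmeas_Im.
under eq_fun do rewrite sumEFin.
apply: cvg_EFin; first exact: nearW.
have := cvg_complex_Im (@cmeas_sigma_additive _ _ _ mu _ mF tF).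
by under eq_fun do rewrite raddf_sum.
Qed.

HB.instance Definition _ := isCharge.Build _ _ _ cmeas_Im
  cmeas_Im0 (fun _ _ => erefl) cmeas_Im_sigma_additive.

End complex_measure_parts.

Section complex_integrals.
Context d (T : measurableType d) (R : realType).
Implicit Types (D : set T) (f : T -> R[i]).

Definition Cintegrable (mu : {measure set T -> \bar R}) D f : Prop :=
  mu.-integrable D (fun x => (complex.Re (f x))%:E) /\
  mu.-integrable D (fun x => (complex.Im (f x))%:E).

Definition Cintegral (mu : {measure set T -> \bar R}) D f : R[i] :=
  (\int[mu]_(x in D) complex.Re (f x)) +i* (\int[mu]_(x in D) complex.Im (f x)).

Section charge.
Variable nu : {charge set T -> \bar R}.

Let exP := cid (Hahn_decomposition nu).
Let exN := cid (svalP exP).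

(* An arbitrary Hahn decomposition is chosen: it is unique up to nu-null sets,
   so the Jordan decomposition of nu does not depend on the choice. *)
Definition Hahn_pos : set T := sval exP.
Definition Hahn_neg : set T := sval exN.

Lemma Hahn_pos_neg : hahn_decomposition nu Hahn_pos Hahn_neg.
Proof. exact: svalP exN. Qed.

Definition charge_integral D f : R[i] :=
  Cintegral (jordan_pos Hahn_pos_neg) D f
  - Cintegral (jordan_neg Hahn_pos_neg) D f.

End charge.

Definition cmeas_integral (mu : complex_measure T R) D f : R[i] :=
  charge_integral (cmeas_Re mu) D f + 'i%C * charge_integral (cmeas_Im mu) D f.

End complex_integrals.

Section carleman.
Context (R : realType).
Implicit Types (mu : complex_measure (measurableTypeR R) R) (z : R[i]).

Definition cexp z : R[i] :=
  (expR (complex.Re z))%:C * (cos (complex.Im z) +i* sin (complex.Im z)).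

Definition fourier mu (x : R) : R[i] :=
  ((Num.sqrt (2 * pi))^-1)%:C *
  cmeas_integral mu setT (fun t : R => cexp (- 'i%C * x%:C * t%:C)).

(* mu - (1/2) mu({0}) delta *)
Definition halve_atom0 mu : complex_measure (measurableTypeR R) R :=
  cmeas_add mu
    (cmeas_scale (- (2^-1 * mu [set 0]))
       (cmeas_dirac R (0 : measurableTypeR R))).

Definition carleman_pos mu z : R[i] :=
  cmeas_integral (halve_atom0 mu) `[0, +oo[
    (fun t : R => cexp ('i%C * t%:C * z)).

Definition carleman_neg mu z : R[i] :=
  - cmeas_integral (halve_atom0 mu) `]-oo, 0]
    (fun t : R => cexp ('i%C * t%:C * z)).

(* Meaningful for non-real z only: the value at real z is junk. *)
Definition carleman mu z : R[i] :=
  if 0 < complex.Im z then carleman_pos mu z else carleman_neg mu z.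

(* Integrability on each [-N, N] is part of existence because the library
   integral is total. *)
Definition VP_exists (f : R -> R[i]) : Prop :=
  (forall N : R, Cintegrable lebesgue_measure `[- N, N] f) /\
  cvg (Cintegral lebesgue_measure `[- N, N] f @[N --> +oo]).

Definition VP_integral (f : R -> R[i]) : R[i] :=
  lim (Cintegral lebesgue_measure `[- N, N] f @[N --> +oo]).

End carleman.

(* Main.v *)
Require Import Defs.
From mathcomp Require Import all_boot all_order all_algebra.
From mathcomp Require Import complex.
From mathcomp Require Import all_classical all_reals all_analysis.
From mathcomp Require Import measurable_realfun.
From mathcomp Require Import ring lra.
Import Order.TTheory GRing.Theory Num.Theory.
Import numFieldNormedType.Exports.
Import Normc.
Local Open Scope classical_set_scope.
Local Open Scope ring_scope.
Local Open Scope complex_scope.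

(** The truncated integrals [K_N(t)] of [e^(-i s t) / (s + z)] over [[-N, N]] are
compared with the integrals of the same form over half-circles of radius [N].
As [(e^(-i t u) - 1) / u] is the integral of [- i t e^(-i r t u)] over [r] in
[[0, 1]] and the latter function of [u] has a primitive, Fubini's theorem shows
that [e^(-i z t) J(t) - J(0)], where [J] is the integral along a curve, depends
only on the end points of that curve. On the half-circle on which [e^(-i w t)]
is bounded by 1, [J(t)] is bounded uniformly in [t] and in [N] and tends to 0
for [t <> 0]; and [J(0)] tends to [+- i pi]. Moreover, the integrals [J(0)] over
the segment and over the half-circle that does not go round the pole [-z] are
equal, since [1/u] has a primitive on a half-plane. Hence [K_N] is uniformly
bounded and converges to [-2 pi i sgn(Im z)] times [e^(i t z)], [1/2] or [0]
according to the sign of [t Im z]; Fubini's theorem and dominated convergence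
for each part of the Jordan decomposition of the measure conclude. *)

Set Implicit Arguments.
Unset Strict Implicit.
Unset Printing Implicit Defensive.

(** * Complex-valued functions, handled through their real and imaginary parts *)

Section modulus.
Context {R : realType}.
Implicit Types z w : R[i].

Lemma normr_normc z : `|z| = (normc z)%:C.
Proof. by []. Qed.

Lemma normc_ge0 z : 0 <= normc z.
Proof. by case: z => a b /=; exact: sqrtr_ge0. Qed.

Lemma normc_sqr z : normc z ^+ 2 = complex.Re z ^+ 2 + complex.Im z ^+ 2.
Proof. by case: z => a b /=; rewrite sqr_sqrtr// addr_ge0// sqr_ge0. Qed.

Lemma Re_le_normc z : `|complex.Re z| <= normc z.
Proof. by have := normc_ge_Re z; rewrite normr_normc lecR. Qed.

Lemma Im_le_normc z : `|complex.Im z| <= normc z.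
Proof.
case: z => a b /=; rewrite -(sqrtr_sqr b) ler_wsqrtr// lerDr; exact: sqr_ge0.
Qed.

Lemma normc_le_Re_Im z : normc z <= `|complex.Re z| + `|complex.Im z|.
Proof.
rewrite {1}(complexE z) (le_trans (le_normcD _ _))// normcM.
rewrite [in leLHS]/normc/= !expr0n expr1n !(addr0,add0r) sqrtr1 mul1r.
by rewrite !sqrtr_sqr.
Qed.

Lemma normcR (a : R) : normc a%:C = `|a|.
Proof. by rewrite /= expr0n addr0 sqrtr_sqr. Qed.

Lemma normc_eq0 z : (normc z == 0) = (z == 0).
Proof.
by apply/eqP/eqP => [/eq0_normc //|->]; rewrite normc0.
Qed.

Lemma normci : normc ('i%C : R[i]) = 1.
Proof. by rewrite /= expr0n expr1n add0r sqrtr1. Qed.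

Lemma ge_normcB z w : normc z - normc w <= normc (z + w).
Proof.
by rewrite lerBlDr -[normc w]normcN (le_trans _ (le_normcD _ _))// addrK.
Qed.

Lemma RecM z w : complex.Re (z * w) =
  complex.Re z * complex.Re w - complex.Im z * complex.Im w.
Proof. by case: z w => [a b] [c d]. Qed.

Lemma ImcM z w : complex.Im (z * w) =
  complex.Re z * complex.Im w + complex.Im z * complex.Re w.
Proof. by case: z w => [a b] [c d]. Qed.

Lemma RecV z : complex.Re z^-1 = complex.Re z * (normc z ^+ 2)^-1.
Proof. by rewrite normc_sqr; case: z. Qed.

Lemma ImcV z : complex.Im z^-1 = - (complex.Im z * (normc z ^+ 2)^-1).
Proof. by rewrite normc_sqr; case: z. Qed.

Lemma RecD z w : complex.Re (z + w) = complex.Re z + complex.Re w.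
Proof. by case: z w => [a b] [c d]. Qed.

Lemma ImcD z w : complex.Im (z + w) = complex.Im z + complex.Im w.
Proof. by case: z w => [a b] [c d]. Qed.

Lemma complex_eqP z w : complex.Re z = complex.Re w ->
  complex.Im z = complex.Im w -> z = w.
Proof. by case: z w => [a b] [c d] /= -> ->. Qed.

Lemma Re_cexp z : complex.Re (cexp z) = expR (complex.Re z) * cos (complex.Im z).
Proof. by rewrite /cexp RecM/= mul0r subr0. Qed.

Lemma Im_cexp z : complex.Im (cexp z) = expR (complex.Re z) * sin (complex.Im z).
Proof. by rewrite /cexp ImcM/= mul0r addr0. Qed.

Lemma cexp0 : cexp 0 = 1 :> R[i].
Proof. by apply: complex_eqP; rewrite ?Re_cexp ?Im_cexp/= expR0 ?cos0 ?sin0 mul1r. Qed.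

Lemma cexpD z w : cexp (z + w) = cexp z * cexp w.
Proof.
apply: complex_eqP.
  by rewrite Re_cexp RecM !Re_cexp !Im_cexp RecD ImcD expRD cosD; ring.
by rewrite Im_cexp ImcM !Re_cexp !Im_cexp RecD ImcD expRD sinD; ring.
Qed.

Lemma normc_cexp z : normc (cexp z) = expR (complex.Re z).
Proof.
apply/eqP; rewrite -(@eqrXn2 _ 2)// ?expR_ge0 ?normc_ge0// normc_sqr.
by rewrite Re_cexp Im_cexp !exprMn -mulrDr cos2Dsin2 mulr1.
Qed.

Lemma cexpNK z : cexp z * cexp (- z) = 1.
Proof. by rewrite -cexpD subrr cexp0. Qed.

End modulus.

(** * Measurability of complex-valued functions *)

Section Cmeasurable.
Context d (T : measurableType d) (R : realType).
Implicit Types (D : set T) (f g : T -> R[i]).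

Definition Cmeasurable D f :=
  measurable_fun D (fun x => complex.Re (f x)) /\
  measurable_fun D (fun x => complex.Im (f x)).

Lemma Cmeasurable_cst D (c : R[i]) : Cmeasurable D (fun=> c).
Proof. by split; exact: measurable_cst. Qed.

Lemma CmeasurableR D (f : T -> R) : measurable_fun D f ->
  Cmeasurable D (fun x => (f x)%:C).
Proof. by move=> mf; split => //=; exact: measurable_cst. Qed.

Lemma CmeasurableD D f g : Cmeasurable D f -> Cmeasurable D g ->
  Cmeasurable D (fun x => f x + g x).
Proof.
move=> [f1 f2] [g1 g2]; split.
  by under eq_fun do rewrite RecD; exact: measurable_funD.
by under eq_fun do rewrite ImcD; exact: measurable_funD.
Qed.

Lemma CmeasurableM D f g : Cmeasurable D f -> Cmeasurable D g ->
  Cmeasurable D (fun x => f x * g x).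
Proof.
move=> [f1 f2] [g1 g2]; split.
  under eq_fun do rewrite RecM.
  by apply: measurable_funB; exact: measurable_funM.
under eq_fun do rewrite ImcM.
by apply: measurable_funD; exact: measurable_funM.
Qed.

Lemma CmeasurableV D f : Cmeasurable D f -> Cmeasurable D (fun x => (f x)^-1).
Proof.
move=> [f1 f2].
have m : measurable_fun D (fun x => (normc (f x) ^+ 2)^-1).
  (* The real inverse is rewritten as the power with exponent -1, which is measurable on the whole
     line; zeros of [f] are covered, since both expressions take the value 0 there. *)
  under eq_fun do rewrite -powR_inv1 ?exprn_ge0 ?normc_ge0// normc_sqr.
  apply: (measurableT_comp (measurable_powR _)).
  by apply: measurable_funD; exact: measurable_funX.
split.
  by under eq_fun do rewrite RecV; exact: measurable_funM.
under eq_fun do rewrite ImcV.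
by apply: measurableT_comp => //; exact: measurable_funM.
Qed.

Lemma Cmeasurable_exp D f : Cmeasurable D f -> Cmeasurable D (fun x => cexp (f x)).
Proof.
move=> [f1 f2]; split.
  under eq_fun do rewrite Re_cexp; apply: measurable_funM.
    exact: measurableT_comp.
  by apply: (measurableT_comp _ f2); apply: continuous_measurable_fun;
    exact: continuous_cos.
under eq_fun do rewrite Im_cexp; apply: measurable_funM.
  exact: measurableT_comp.
by apply: (measurableT_comp _ f2); apply: continuous_measurable_fun;
  exact: continuous_sin.
Qed.

Lemma Cmeasurable_ifT (b : T -> bool) f g : measurable_fun setT b ->
  Cmeasurable setT f -> Cmeasurable setT g ->
  Cmeasurable setT (fun x => if b x then f x else g x).
Proof.
move=> mb [f1 f2] [g1 g2]; split.
  have := measurable_fun_ifT mb f1 g1.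
  by congr (measurable_fun _ _); apply/funext => x; case: (b x).
have := measurable_fun_ifT mb f2 g2.
by congr (measurable_fun _ _); apply/funext => x; case: (b x).
Qed.

End Cmeasurable.

Section Cmeasurable_product.
Context d1 d2 (T1 : measurableType d1) (T2 : measurableType d2) (R : realType).

Lemma Cmeasurable_fst (f : T1 -> R[i]) : Cmeasurable setT f ->
  Cmeasurable setT (fun p : T1 * T2 => f p.1).
Proof.
by move=> [f1 f2]; split; [exact: (measurableT_comp f1 measurable_fst)|
  exact: (measurableT_comp f2 measurable_fst)].
Qed.

Lemma Cmeasurable_swap (f : T1 * T2 -> R[i]) : Cmeasurable setT f ->
  Cmeasurable setT (fun p : T2 * T1 => f (p.2, p.1)).
Proof.
have ms : measurable_fun setT (fun p : T2 * T1 => (p.2, p.1)).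
  by apply: measurable_fun_pair; [exact: measurable_snd|exact: measurable_fst].
by move=> [f1 f2]; split; [exact: (measurableT_comp f1 ms)|
  exact: (measurableT_comp f2 ms)].
Qed.

End Cmeasurable_product.

(** * Differentiation of complex-valued functions of a real variable *)

Section Cderivative.
Context {R : realType}.
Implicit Types (f g : R -> R[i]) (x : R) (a b : R[i]).

(** The variable is real, so differentiating the two components separately is enough and real
    calculus applies to each. *)
Definition is_Cderive x f a :=
  is_derive x 1 (fun s => complex.Re (f s)) (complex.Re a) /\
  is_derive x 1 (fun s => complex.Im (f s)) (complex.Im a).

Lemma is_Cderive_eq x f a b : is_Cderive x f a -> a = b -> is_Cderive x f b.
Proof. by move=> + <-. Qed.

Lemma is_Cderive_cst x a : is_Cderive x (fun=> a) 0.
Proof. by split; exact: is_derive_cst. Qed.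

Lemma is_Cderive_mk x (f g : R -> R) (a b : R) :
  is_derive x 1 f a -> is_derive x 1 g b ->
  is_Cderive x (fun s => f s +i* g s) (a +i* b).
Proof. by []. Qed.

Lemma is_Cderive_id x : is_Cderive x (fun s => s%:C) 1.
Proof. by split; [exact: is_derive_id|exact: is_derive_cst]. Qed.

Lemma is_CderiveD x f g a b : is_Cderive x f a -> is_Cderive x g b ->
  is_Cderive x (fun s => f s + g s) (a + b).
Proof.
move=> [f1 f2] [g1 g2]; split.
  by under eq_fun do rewrite RecD; rewrite RecD; exact: is_deriveD.
by under eq_fun do rewrite ImcD; rewrite ImcD; exact: is_deriveD.
Qed.

Lemma is_CderiveM x f g a b : is_Cderive x f a -> is_Cderive x g b ->
  is_Cderive x (fun s => f s * g s) (a * g x + f x * b).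
Proof.
move=> [f1 f2] [g1 g2]; split.
  under eq_fun do rewrite RecM.
  apply: (is_derive_eq (is_deriveB (is_deriveM f1 g1) (is_deriveM f2 g2))).
  by rewrite RecD !RecM /GRing.scale/=; ring.
under eq_fun do rewrite ImcM.
apply: (is_derive_eq (is_deriveD (is_deriveM f1 g2) (is_deriveM f2 g1))).
by rewrite ImcD !ImcM /GRing.scale/=; ring.
Qed.

Lemma is_Cderive_exp x f a : is_Cderive x f a ->
  is_Cderive x (fun s => cexp (f s)) (a * cexp (f x)).
Proof.
move=> [f1 f2]; split.
  under eq_fun do rewrite Re_cexp.
  have e1 := is_derive1_comp (is_derive_expR (complex.Re (f x))) f1.
  have e2 := is_derive1_comp (is_derive_cos (complex.Im (f x))) f2.
  apply: (is_derive_eq (is_deriveM e1 e2)).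
  by rewrite RecM Re_cexp Im_cexp /GRing.scale/=; ring.
under eq_fun do rewrite Im_cexp.
have e1 := is_derive1_comp (is_derive_expR (complex.Re (f x))) f1.
have e2 := is_derive1_comp (is_derive_sin (complex.Im (f x))) f2.
apply: (is_derive_eq (is_deriveM e1 e2)).
by rewrite ImcM Re_cexp Im_cexp /GRing.scale/=; ring.
Qed.

Lemma is_CderiveV x f a : f x != 0 -> is_Cderive x f a ->
  is_Cderive x (fun s => (f s)^-1) (- a * (f x)^-2).
Proof.
move=> fx0 [f1 f2].
have nE s : normc (f s) ^+ 2 = complex.Re (f s) * complex.Re (f s) +
   complex.Im (f s) * complex.Im (f s) by rewrite normc_sqr.
have n0 : normc (f x) ^+ 2 != 0 by rewrite expf_neq0// normc_eq0.
rewrite nE in n0.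
have dn := @is_deriveV R (fun s => complex.Re (f s) * complex.Re (f s) +
  complex.Im (f s) * complex.Im (f s)) x _ 1 n0
  (is_deriveD (is_deriveM f1 f1) (is_deriveM f2 f2)).
have aE : - a * (f x)^-2 = - a * ((f x)^-1 * (f x)^-1) by rewrite -invfM.
split.
  under eq_fun do rewrite RecV nE.
  apply: (is_derive_eq (is_deriveM f1 dn)).
  rewrite aE !RecM !ImcM !RecV !ImcV !nE raddfN/= raddfN /GRing.scale/=.
  by move: n0; rewrite /= => n0; field.
under eq_fun do rewrite ImcV nE.
apply: (is_derive_eq (is_deriveN (is_deriveM f2 dn))).
rewrite aE !ImcM !RecM !RecV !ImcV !nE raddfN/= raddfN /GRing.scale/=.
by move: n0; rewrite /= => n0; field.
Qed.

Lemma is_CderiveZ x c f a : is_Cderive x f a ->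
  is_Cderive x (fun s => c * f s) (c * a).
Proof.
move=> /(is_CderiveM (is_Cderive_cst x c)) df.
by apply: (is_Cderive_eq df); rewrite mul0r add0r.
Qed.

(** Mere existence of a derivative is the form in which continuity is carried along: it yields
    measurability and the continuity of integrands in the fundamental theorem of calculus, without
    any derivative being computed. *)
Definition Cderivable x f := exists a, is_Cderive x f a.

Lemma Cderivable_cst x a : Cderivable x (fun=> a).
Proof. by exists 0; exact: is_Cderive_cst. Qed.

Lemma Cderivable_id x : Cderivable x (fun s => s%:C).
Proof. by exists 1; exact: is_Cderive_id. Qed.

Lemma CderivableD x f g : Cderivable x f -> Cderivable x g ->
  Cderivable x (fun s => f s + g s).
Proof. by move=> [a da] [b db]; exists (a + b); exact: is_CderiveD. Qed.

Lemma CderivableM x f g : Cderivable x f -> Cderivable x g ->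
  Cderivable x (fun s => f s * g s).
Proof. by move=> [a da] [b db]; exact: (ex_intro _ _ (is_CderiveM da db)). Qed.

Lemma CderivableV x f : f x != 0 -> Cderivable x f ->
  Cderivable x (fun s => (f s)^-1).
Proof. by move=> fx0 [a da]; exact: (ex_intro _ _ (is_CderiveV fx0 da)). Qed.

Lemma Cderivable_exp x f : Cderivable x f -> Cderivable x (fun s => cexp (f s)).
Proof. by move=> [a da]; exact: (ex_intro _ _ (is_Cderive_exp da)). Qed.

Lemma Cderivable_measurable f : (forall x, Cderivable x f) ->
  Cmeasurable (setT : set (measurableTypeR R)) f.
Proof.
move=> df; have cont (g : R -> R) : (forall x, derivable g x 1) -> continuous g.
  by move=> dg x; apply: differentiable_continuous; apply/derivable1_diffP; exact: dg.
split; apply: continuous_measurable_fun; apply: cont => x;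
  have [a [da db]] := df x.
  by case: da.
by case: db.
Qed.

End Cderivative.

(** * Convergence of complex-valued functions along an arbitrary filter *)

Section complex_convergence.
Context {R : realType} {T : Type} {F : set_system T} {FF : Filter F}.
Implicit Types (f : T -> R[i]) (l : R[i]).

Lemma cvg_Re f l : f @ F --> l -> complex.Re (f x) @[x --> F] --> complex.Re l.
Proof.
move=> /cvgrPdist_lt fl; apply/cvgrPdist_lt => e e0.
have := fl e%:C; rewrite ltcR => /(_ e0); apply: filterS => x h.
by rewrite -raddfB -ltcR; exact: le_lt_trans (normc_ge_Re _) h.
Qed.

Lemma cvg_Im f l : f @ F --> l -> complex.Im (f x) @[x --> F] --> complex.Im l.
Proof.
move=> /cvgrPdist_lt fl; apply/cvgrPdist_lt => e e0.
have := fl e%:C; rewrite ltcR => /(_ e0); apply: filterS => x.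
rewrite normr_normc ltcR -raddfB; exact: le_lt_trans (Im_le_normc _).
Qed.

Lemma cvg_normc_le f l (e : T -> R) : (\forall x \near F, normc (f x - l) <= e x) ->
  e x @[x --> F] --> 0 -> f @ F --> l.
Proof.
move=> fe /cvgr0_norm_le e0; apply/cvgrPdist_le => r r0.
(* The radius [r] of a ball in [R[i]] is itself a complex number; being positive for the order of
   [R[i]], it is real. *)
have rE : (complex.Re r)%:C = r by rewrite RRe_real// gtr0_real.
have {}r0 : 0 < complex.Re r by rewrite -ltcR rE.
have := e0 _ r0; apply: filterS2 fe => x fex exr.
rewrite distrC -rE normr_normc lecR (le_trans fex)// (le_trans _ exr)//.
exact: ler_norm.
Qed.

Lemma cvg_Re_Im f l : complex.Re (f x) @[x --> F] --> complex.Re l ->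
  complex.Im (f x) @[x --> F] --> complex.Im l -> f @ F --> l.
Proof.
move=> /subr_cvg0/cvg_norm; rewrite normr0 => rl.
move=> /subr_cvg0/cvg_norm; rewrite normr0 => il.
apply: (@cvg_normc_le _ _ (fun x => `|complex.Re (f x) - complex.Re l| +
    `|complex.Im (f x) - complex.Im l|)); last first.
  by rewrite -[X in _ --> X]addr0; exact: cvgD rl il.
apply: nearW => x; rewrite (le_trans (normc_le_Re_Im _))//.
by rewrite (raddfB (@complex.Re R)) (raddfB (@complex.Im R)).
Qed.

End complex_convergence.

(** * Linearity, bounds and dominated convergence for complex integrals *)

Section Cintegral_theory.
Context d (T : measurableType d) (R : realType).
Variable m : {measure set T -> \bar R}.
Implicit Types (D : set T) (f g : T -> R[i]).

Lemma integrable_le_cst D (f : T -> R) M : measurable D -> (m D < +oo)%E ->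
  measurable_fun D f -> (forall x, D x -> `|f x| <= M) ->
  m.-integrable D (EFin \o f).
Proof.
move=> mD Dfin mf fM; apply: measurable_bounded_integrable => //.
exists M; split; first exact: num_real.
by move=> N MN x Dx /=; exact: le_trans (fM x Dx) (ltW MN).
Qed.

Lemma Cintegrable_bounded D f M : measurable D -> (m D < +oo)%E ->
  Cmeasurable D f -> (forall x, D x -> normc (f x) <= M) -> Cintegrable m D f.
Proof.
move=> mD Dfin [mf1 mf2] fM; split.
  apply: (@integrable_le_cst _ _ M) => // x Dx.
  exact: le_trans (Re_le_normc _) (fM x Dx).
apply: (@integrable_le_cst _ _ M) => // x Dx.
exact: le_trans (Im_le_normc _) (fM x Dx).
Qed.

Lemma eq_Cintegral D f g : {in D, f =1 g} -> Cintegral m D f = Cintegral m D g.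
Proof.
move=> fg; rewrite /Cintegral; congr (_ +i* _);
  by apply: eq_Rintegral => x xD; rewrite fg.
Qed.

Lemma CintegrableD D f g : measurable D -> Cintegrable m D f ->
  Cintegrable m D g -> Cintegrable m D (fun x => f x + g x).
Proof.
move=> mD [f1 f2] [g1 g2]; split.
  by under eq_fun do rewrite RecD EFinD; exact: integrableD.
by under eq_fun do rewrite ImcD EFinD; exact: integrableD.
Qed.

Lemma CintegralD D f g : measurable D -> Cintegrable m D f ->
  Cintegrable m D g ->
  Cintegral m D (fun x => f x + g x) = Cintegral m D f + Cintegral m D g.
Proof.
move=> mD [f1 f2] [g1 g2]; apply: complex_eqP; rewrite /= -RintegralD//;
  by apply: eq_Rintegral => x _; rewrite (RecD, ImcD).
Qed.

Lemma CintegrableZl D f c : measurable D -> Cintegrable m D f ->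
  Cintegrable m D (fun x => c * f x).
Proof.
move=> mD [f1 f2]; split.
  under eq_fun do rewrite RecM EFinB !EFinM.
  by apply: integrableB => //; exact: integrableZl.
under eq_fun do rewrite ImcM EFinD !EFinM.
by apply: integrableD => //; exact: integrableZl.
Qed.

Lemma CintegralZl D f c : measurable D -> Cintegrable m D f ->
  Cintegral m D (fun x => c * f x) = c * Cintegral m D f.
Proof.
move=> mD [f1 f2].
have i k (h : T -> R) : m.-integrable D (EFin \o h) ->
    m.-integrable D (EFin \o (fun x => k * h x)).
  by move=> ih; apply: eq_integrable (integrableZl mD k ih) => // x _.
apply: complex_eqP; rewrite ?RecM ?ImcM /= -!RintegralZl// -(RintegralB, RintegralD)//;
  try exact: i; by apply: eq_Rintegral => x _; rewrite (RecM, ImcM).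
Qed.

Lemma CintegralZr D f c : measurable D -> Cintegrable m D f ->
  Cintegral m D (fun x => f x * c) = Cintegral m D f * c.
Proof.
move=> mD fi; rewrite mulrC -CintegralZl//.
by apply: eq_Cintegral => x _; rewrite mulrC.
Qed.

Lemma CintegralB D f g : measurable D -> Cintegrable m D f ->
  Cintegrable m D g ->
  Cintegral m D (fun x => f x - g x) = Cintegral m D f - Cintegral m D g.
Proof.
move=> mD fi gi; rewrite -[in RHS]mulN1r -CintegralZl// -CintegralD//.
  by apply: eq_Cintegral => x _; rewrite mulN1r.
exact: CintegrableZl.
Qed.

Lemma Cintegral_setU (A B : set T) f : measurable A -> measurable B ->
  Cintegrable m (A `|` B) f -> [disjoint A & B] ->
  Cintegral m (A `|` B) f = Cintegral m A f + Cintegral m B f.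
Proof.
by move=> mA mB [f1 f2] AB; apply: complex_eqP => /=; rewrite Rintegral_setU.
Qed.

Lemma Rintegral_le_cst D (f : T -> R) M : measurable D -> (m D < +oo)%E ->
  measurable_fun D f -> (forall x, D x -> `|f x| <= M) ->
  `|\int[m]_(x in D) f x| <= M * fine (m D).
Proof.
move=> mD Dfin mf fM.
have fi := integrable_le_cst mD Dfin mf fM.
rewrite (le_trans (le_normr_Rintegral _ _))// -Rintegral_cst//.
apply: le_Rintegral => //.
  exact: (integrable_norm fi).
exact: (@integrable_le_cst _ (cst M) `|M|).
Qed.

(** The real and imaginary parts are bounded separately, whence the factor 2; this crude constant is
    harmless below. *)
Lemma normc_Cintegral_le D f M : measurable D -> (m D < +oo)%E ->
  Cmeasurable D f -> (forall x, D x -> normc (f x) <= M) ->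
  normc (Cintegral m D f) <= 2 * (M * fine (m D)).
Proof.
move=> mD Dfin [f1 f2] fM; rewrite (le_trans (normc_le_Re_Im _))//=.
rewrite mulr_natl mulr2n lerD// Rintegral_le_cst// => x Dx.
  exact: le_trans (Re_le_normc _) (fM x Dx).
exact: le_trans (Im_le_normc _) (fM x Dx).
Qed.

Lemma Rintegral_dominated_cvg D (f : (T -> R)^nat) (g : T -> R) M :
  measurable D -> (m D < +oo)%E ->
  (forall n, measurable_fun D (f n)) -> measurable_fun D g ->
  {ae m, forall x, D x -> f ^~ x @ \oo --> g x} ->
  (forall n x, D x -> `|f n x| <= M) ->
  \int[m]_(x in D) f n x @[n --> \oo] --> \int[m]_(x in D) g x.
Proof.
move=> mD Dfin mf mg fg fM.
have iM : m.-integrable D (cst M%:E).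
  apply: (@integrable_le_cst _ (cst M) `|M|) => //.
have [] := @dominated_convergence _ _ _ m D mD (fun n x => (f n x)%:E)
  (EFin \o g) (cst M%:E).
- by move=> n; exact/measurable_EFinP.
- exact/measurable_EFinP.
- apply: filterS fg => x h Dx; apply: cvg_EFin; first exact: nearW.
  exact: h.
- exact: iM.
- by apply: aeW => x n Dx; rewrite lee_fin fM.
move=> gi _ cv; apply: fine_cvg; rewrite /= fineK//.
exact: integrable_fin_num gi.
Qed.

Lemma Cintegral_dominated_cvg D (f : (T -> R[i])^nat) (g : T -> R[i]) M :
  measurable D -> (m D < +oo)%E ->
  (forall n, Cmeasurable D (f n)) -> Cmeasurable D g ->
  {ae m, forall x, D x -> f n x @[n --> \oo] --> g x} ->
  (forall n x, D x -> normc (f n x) <= M) ->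
  Cintegral m D (f n) @[n --> \oo] --> Cintegral m D g.
Proof.
move=> mD Dfin mf mg fg fM; apply: cvg_Re_Im => /=.
  apply: (@Rintegral_dominated_cvg _ (fun n x => complex.Re (f n x)) _ M) => //.
  - by move=> n; case: (mf n).
  - by case: mg.
  - by apply: filterS fg => x h /h/cvg_Re.
  - by move=> n x Dx; exact: le_trans (Re_le_normc _) (fM n x Dx).
apply: (@Rintegral_dominated_cvg _ (fun n x => complex.Im (f n x)) _ M) => //.
- by move=> n; case: (mf n).
- by case: mg.
- by apply: filterS fg => x h /h/cvg_Im.
- by move=> n x Dx; exact: le_trans (Im_le_normc _) (fM n x Dx).
Qed.

End Cintegral_theory.

(** * Fubini's theorem for bounded functions on sets of finite measure *)

Section Fubini_bounded.
Context d1 d2 (T1 : measurableType d1) (T2 : measurableType d2) (R : realType).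
Variable m1 : {sigma_finite_measure set T1 -> \bar R}.
Variable m2 : {sigma_finite_measure set T2 -> \bar R}.
Variables (D1 : set T1) (D2 : set T2).
Hypotheses (mD1 : measurable D1) (mD2 : measurable D2).
Hypotheses (D1fin : (m1 D1 < +oo)%E) (D2fin : (m2 D2 < +oo)%E).

Lemma Rintegral_Fubini_bounded (f : T1 * T2 -> R) (M : R) :
  measurable_fun setT f ->
  (forall x y, D1 x -> D2 y -> `|f (x, y)| <= M) ->
  m1.-integrable D1 (EFin \o (fun x => \int[m2]_(y in D2) f (x, y))) /\
  \int[m1]_(x in D1) \int[m2]_(y in D2) f (x, y) =
  \int[m2]_(y in D2) \int[m1]_(x in D1) f (x, y).
Proof.
move=> mf fM.
(* Extension by zero outside the rectangle reduces the claim to Fubini's theorem on the whole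
   product; [FE] and [GE] identify the partial integrals of [g] with those of [f], again extended by
   zero. *)
pose g := f \_ (D1 `*` D2).
have mDD : measurable (D1 `*` D2) by exact: measurableX.
have iDf : (m1 \x m2)%E.-integrable (D1 `*` D2) (EFin \o f).
  apply: (@integrable_le_cst _ _ _ _ _ _ M) => //.
  - suff : ((m1 \x m2)%E (D1 `*` D2) < +oo)%E by [].
    by rewrite product_measure1E// lte_mul_pinfty// ge0_fin_numE.
  - exact: measurable_funTS.
  - by move=> -[x y] [/= Dx Dy]; exact: fM.
have ig : (m1 \x m2)%E.-integrable setT (EFin \o g).
  have := (integrable_mkcond (EFin \o f) mDD).1 iDf.
  by rewrite restrict_EFin.
have sec1 x : measurable_fun setT (fun y => f (x, y)).
  exact: measurableT_comp.
have sec2 y : measurable_fun setT (fun x => f (x, y)).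
  exact: measurableT_comp.
have i1 x : D1 x -> m2.-integrable D2 (EFin \o (fun y => f (x, y))).
  move=> Dx; apply: (@integrable_le_cst _ _ _ _ _ _ M) => //.
    exact: measurable_funTS.
  by move=> y Dy; exact: fM.
have i2 y : D2 y -> m1.-integrable D1 (EFin \o (fun x => f (x, y))).
  move=> Dy; apply: (@integrable_le_cst _ _ _ _ _ _ M) => //.
    exact: measurable_funTS.
  by move=> x Dx; exact: fM.
have FE : fubini_F m2 (EFin \o g) =
    (EFin \o (fun x => \int[m2]_(y in D2) f (x, y))) \_ D1.
  apply/funext => x; rewrite /fubini_F /patch; case: ifPn => [|]; rewrite ?inE ?notin_setE.
    move=> Dx; rewrite /= /Rintegral fineK; last exact: integrable_fin_num (i1 x Dx).
    rewrite [RHS]integral_mkcond; apply: eq_integral => y _.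
    rewrite /g /patch /=; case: ifPn; rewrite ?inE ?notin_setE.
      by move=> -[_ /= Dy]; rewrite mem_set.
    by move=> nDD; case: ifPn => //; rewrite inE => Dy; exfalso; exact: nDD.
  move=> nD; apply: integral0_eq => y _; rewrite /g /= /patch.
  by case: ifPn => //; rewrite inE => -[/= ].
have GE : fubini_G m1 (EFin \o g) =
    (EFin \o (fun y => \int[m1]_(x in D1) f (x, y))) \_ D2.
  apply/funext => y; rewrite /fubini_G /patch; case: ifPn => [|]; rewrite ?inE ?notin_setE.
    move=> Dy; rewrite /= /Rintegral fineK; last exact: integrable_fin_num (i2 y Dy).
    rewrite [RHS]integral_mkcond; apply: eq_integral => x _.
    rewrite /g /patch /=; case: ifPn; rewrite ?inE ?notin_setE.
      by move=> -[/= Dx _]; rewrite mem_set.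
    by move=> nDD; case: ifPn => //; rewrite inE => Dx; exfalso; exact: nDD.
  move=> nD; apply: integral0_eq => x _; rewrite /g /= /patch.
  by case: ifPn => //; rewrite inE => -[/= ].
split.
  by apply/(integrable_mkcond _ mD1).2; rewrite -FE; exact: integrable_fubini_F.
rewrite [LHS]/Rintegral [RHS]/Rintegral; congr fine.
rewrite [LHS]integral_mkcond [RHS]integral_mkcond.
have : (\int[m1]_x fubini_F m2 (EFin \o g) x =
        \int[m2]_y fubini_G m1 (EFin \o g) y)%E := Fubini ig.
by rewrite FE GE.
Qed.

Lemma Cintegral_Fubini_bounded (f : T1 * T2 -> R[i]) M :
  Cmeasurable setT f ->
  (forall x y, D1 x -> D2 y -> normc (f (x, y)) <= M) ->
  Cintegrable m1 D1 (fun x => Cintegral m2 D2 (fun y => f (x, y))) /\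
  Cintegral m1 D1 (fun x => Cintegral m2 D2 (fun y => f (x, y))) =
  Cintegral m2 D2 (fun y => Cintegral m1 D1 (fun x => f (x, y))).
Proof.
move=> [mf1 mf2] fM.
have [|i1 e1] := @Rintegral_Fubini_bounded _ M mf1.
  by move=> x y Dx Dy; exact: le_trans (Re_le_normc _) (fM x y Dx Dy).
have [|i2 e2] := @Rintegral_Fubini_bounded _ M mf2.
  by move=> x y Dx Dy; exact: le_trans (Im_le_normc _) (fM x y Dx Dy).
by split; [split|apply: complex_eqP].
Qed.

End Fubini_bounded.

(** * The fundamental theorem of calculus, and the length of compact intervals *)

Section FTC.
Context {R : realType}.
Notation leb := (@lebesgue_measure R).

Lemma Cintegral_FTC (a b : R) (F f : R -> R[i]) : a < b ->
  (forall x, a <= x <= b -> is_Cderive x F (f x)) ->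
  (forall x, a <= x <= b -> Cderivable x f) ->
  Cintegral leb `[a, b] f = F b - F a.
Proof.
move=> ab dF df.
have key (G g : R -> R) :
    (forall x, a <= x <= b -> is_derive x 1 G (g x)) ->
    (forall x, a <= x <= b -> derivable g x 1) ->
    \int[leb]_(x in `[a, b]) g x = G b - G a.
  move=> dG dg.
  have cG x : a <= x <= b -> {for x, continuous G}.
    move=> abx; have dGx := dG x abx.
    by apply/differentiable_continuous/derivable1_diffP; case: dGx.
  rewrite /Rintegral (@continuous_FTC2 _ g G)//.
  - apply: derivable_within_continuous => x; rewrite in_itv/= => abx.
    exact: dg.
  - split.
    + move=> x /subset_itv_oo_cc; rewrite in_itv/= => abx.
      by have dGx := dG x abx; case: dGx.
    + by apply: cvg_at_right_filter; apply: cG; rewrite lexx ltW.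
    + by apply: cvg_at_left_filter; apply: cG; rewrite lexx ltW.
  - move=> x /subset_itv_oo_cc; rewrite in_itv/= => abx.
    by rewrite derive1E; have dGx := dG x abx; case: dGx.
apply: complex_eqP; rewrite (raddfB (@complex.Re R), raddfB (@complex.Im R)) /=.
- apply: (key (fun x => complex.Re (F x)) (fun x => complex.Re (f x))) => x abx.
    by case: (dF x abx).
  by have [a' [da db]] := df x abx; case: da.
- apply: (key (fun x => complex.Im (F x)) (fun x => complex.Im (f x))) => x abx.
    by case: (dF x abx).
  by have [a' [da db]] := df x abx; case: db.
Qed.

(** The end points are in no prescribed order because the truncations [[- N, N]] range over all real
    [N], negative ones included. *)
Lemma lebesgue_itvcc_fin (a b : R) : (leb `[a, b] < +oo)%E.
Proof. by rewrite lebesgue_measure_itv/=; case: ifP => // _; rewrite ltry. Qed.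

Lemma fine_lebesgue_itvcc (a b : R) : a <= b -> fine (leb `[a, b]) = b - a.
Proof.
rewrite lebesgue_measure_itv/= lte_fin le_eqVlt => /predU1P[->|->//].
by rewrite ltxx subrr.
Qed.

End FTC.

(** * Integrals of [e^(-i w t) / (w + z)] along curves *)

Section curve_integrals.
Context {R : realType}.
Notation leb := (@lebesgue_measure R).
Variable z : R[i].
Implicit Types (c dc : R -> R[i]) (t : R).

(** The curve is [c], and [dc] stands for its derivative; the link between the two is imposed only
    in the lemmas. *)
Definition fourier_cauchy c dc (a b : R) t : R[i] :=
  Cintegral leb `[a, b]
    (fun s => cexp (- 'i%C * c s * t%:C) * (dc s / (c s + z))).

(* A primitive, as a function of [u], of [u |-> - i t e^(- i t u r)]. *)
Definition exp_primitive t (u : R[i]) (r : R) : R[i] :=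
  if r == 0 then - 'i%C * t%:C * u
  else cexp (- 'i%C * t%:C * u * r%:C) / r%:C.

(** With [u = c s + z], the left side is the integral of [(e^(-i t u) - 1) / u] along the curve.
    Writing this quotient as an integral over [r] removes the denominator, and after the exchange of
    integrals the integrand in [s] has a primitive for every [r]. The right side therefore involves
    only the end points of the curve. *)
Lemma fourier_cauchy_sub c dc (a b B k t : R) : a < b ->
  (forall s, is_Cderive s c (dc s)) -> (forall s, Cderivable s dc) ->
  (forall s, a <= s <= b -> normc (c s) <= B) ->
  (forall s, a <= s <= b -> normc (dc s) <= B) ->
  0 < k -> (forall s, a <= s <= b -> k <= normc (c s + z)) ->
  cexp (- 'i%C * z * t%:C) * fourier_cauchy c dc a b t -
    fourier_cauchy c dc a b 0 =
  Cintegral leb `[0, 1]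
    (fun r => exp_primitive t (c b + z) r - exp_primitive t (c a + z) r).
Proof.
move=> ab dcc dcdc cB dcB k0 ck.
have B0 : 0 <= B by rewrite (le_trans (normc_ge0 (c a)))// cB// lexx ltW.
have mc : Cmeasurable (setT : set (measurableTypeR R)) c.
  by apply: Cderivable_measurable => s; exists (dc s).
have mdc : Cmeasurable (setT : set (measurableTypeR R)) dc.
  exact: Cderivable_measurable.
have mu : Cmeasurable (setT : set (measurableTypeR R)) (fun s => c s + z).
  by apply: CmeasurableD => //; exact: Cmeasurable_cst.
have u0 s : a <= s <= b -> c s + z != 0.
  by move=> abs; rewrite -normc_eq0 gt_eqF// (lt_le_trans k0)// ck.
have mab : measurable (`[a, b] : set (measurableTypeR R)) by exact: measurable_itv.
have m01 : measurable (`[0, 1] : set (measurableTypeR R)) by exact: measurable_itv.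
have abfin := @lebesgue_itvcc_fin R a b.
(* Stated for every [t'] because it is applied at both [t] and 0; [B * |t'|] bounds the exponent and
   [B / k] the quotient. *)
have int_u t' : Cintegrable leb `[a, b]
    (fun s => cexp (- 'i%C * c s * t'%:C) * (dc s / (c s + z))).
  apply: (@Cintegrable_bounded _ _ _ _ _ _ (expR (B * `|t'|) * (B / k))) => //.
    suff [] : Cmeasurable (setT : set (measurableTypeR R))
        (fun s => cexp (- 'i%C * c s * t'%:C) * (dc s / (c s + z))).
      by move=> m1 m2; split; exact: measurable_funTS.
    apply: CmeasurableM; last by apply: CmeasurableM => //; exact: CmeasurableV.
    apply: Cmeasurable_exp; apply: CmeasurableM; last exact: Cmeasurable_cst.
    by apply: CmeasurableM => //; exact: Cmeasurable_cst.
  move=> s /=; rewrite in_itv/= => abs.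
  rewrite normcM normc_cexp normcM normcV ler_pM ?mulr_ge0 ?invr_ge0 ?normc_ge0 ?expR_ge0//.
    rewrite ler_expR (le_trans (ler_norm _))// (le_trans (Re_le_normc _))//.
    rewrite 2!normcM normcN normci mul1r normcR ler_wpM2r//; exact: cB.
  rewrite ler_pM ?invr_ge0 ?normc_ge0//; first exact: dcB.
  rewrite lef_pV2 ?posrE//; first exact: ck.
  by rewrite (lt_le_trans k0)// ck.
pose f (p : measurableTypeR R * measurableTypeR R) : R[i] :=
  - 'i%C * t%:C * dc p.1 * cexp (- 'i%C * t%:C * (c p.1 + z) * p.2%:C).
(* Integrating [f] in [r] first gives back the difference quotient, by means of a primitive in
   [r]. *)
transitivity (Cintegral leb `[a, b] (fun s => Cintegral leb `[0, 1] (fun r => f (s, r)))).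
  rewrite -CintegralZl// -CintegralB//; last exact: CintegrableZl.
  apply: eq_Cintegral => s; rewrite inE/= in_itv/= => abs.
  rewrite (Cintegral_FTC (a := 0) (b := 1) ltr01 (F := fun r =>
    dc s / (c s + z) * cexp (- 'i%C * t%:C * (c s + z) * r%:C))).
  - rewrite !mulr0 cexp0 mulr1 mulrA -cexpD mul1r mulrC; congr (_ * cexp _ - _).
    by ring.
  - move=> r _; apply: is_Cderive_eq.
      apply: is_CderiveZ; apply: is_Cderive_exp; apply: is_CderiveZ.
      exact: is_Cderive_id.
    by rewrite /f/=; field; exact: u0.
  - move=> r _; rewrite /f/=; apply: CderivableM; first exact: Cderivable_cst.
    apply: Cderivable_exp; apply: CderivableM; first exact: Cderivable_cst.
    exact: Cderivable_id.
have mf : Cmeasurable setT f.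
  apply: CmeasurableM.
    by apply: CmeasurableM; [exact: Cmeasurable_cst|exact: Cmeasurable_fst mdc].
  apply: Cmeasurable_exp; apply: CmeasurableM.
    by apply: CmeasurableM; [exact: Cmeasurable_cst|exact: Cmeasurable_fst mu].
  by apply: CmeasurableR; exact: measurable_snd.
(* The bound uses [|dc s| <= B] for the factor in front, and [|c s + z| <= B + |z|] together with
   [r <= 1] for the exponent. *)
have [|_ ->] := @Cintegral_Fubini_bounded _ _ _ _ _ leb leb _ _ mab m01 abfin
    (@lebesgue_itvcc_fin R 0 1) f (`|t| * B * expR (`|t| * (B + normc z))) mf.
  move=> s r /=; rewrite !in_itv/= => abs /andP[r0 r1].
  rewrite /f/= normcM normc_cexp 2!normcM normcN normci mul1r normcR.
  rewrite ler_pM ?mulr_ge0 ?normc_ge0 ?expR_ge0//.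
    by rewrite ler_wpM2l// dcB.
  rewrite ler_expR (le_trans (ler_norm _))// (le_trans (Re_le_normc _))//.
  rewrite 3!normcM normcN normci mul1r !normcR (ger0_norm r0).
  rewrite -[leRHS]mulr1 ler_pM ?mulr_ge0 ?normc_ge0// ler_wpM2l//.
  by rewrite (le_trans (le_normcD _ _))// lerD2r cB.
apply: eq_Cintegral => r _; rewrite /exp_primitive /f /=.
have du s : is_Cderive s (fun s => c s + z) (dc s).
  apply: is_Cderive_eq; first by apply: is_CderiveD => //; exact: is_Cderive_cst.
  by rewrite addr0.
have df s : Cderivable s (fun s => - 'i%C * t%:C * dc s *
    cexp (- 'i%C * t%:C * (c s + z) * r%:C)).
  apply: CderivableM; first by apply: CderivableM => //; exact: Cderivable_cst.
  apply: Cderivable_exp; apply: CderivableM; last exact: Cderivable_cst.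
  by apply: CderivableM; [exact: Cderivable_cst|exists (dc s)].
(* For [r = 0] the exponential is constantly 1, and its primitive is linear in [u] instead of
   exponential. *)
have [r0|r0] := eqVneq r 0; last first.
  rewrite (Cintegral_FTC ab (F := fun s => cexp (- 'i%C * t%:C * (c s + z) * r%:C) / r%:C))//.
  move=> s _; apply: is_Cderive_eq.
    apply: is_CderiveM; last exact: is_Cderive_cst.
    apply: is_Cderive_exp; apply: is_CderiveM; last exact: is_Cderive_cst.
    by apply: is_CderiveZ; exact: du.
  have r0' : r%:C != 0 :> R[i] by rewrite -normc_eq0 normcR normr_eq0.
  by rewrite !mulr0 !addr0; field.
rewrite r0 in df *.
rewrite (Cintegral_FTC ab (F := fun s => - 'i%C * t%:C * (c s + z)))//.
  move=> s _; apply: is_Cderive_eq; first by apply: is_CderiveZ; exact: du.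
  by rewrite mulr0 cexp0 mulr1.
Qed.

End curve_integrals.

(** * The logarithm off the real axis *)

Section log_primitive.
Context {R : realType}.

(* A primitive of 1/u on each of the two open half-planes. *)
Definition half_plane_log (u : R[i]) : R[i] :=
  (2^-1 * ln (complex.Re u * complex.Re u + complex.Im u * complex.Im u))
  +i* (- atan (complex.Re u * (complex.Im u)^-1)).

(** The real part of [half_plane_log] is [ln |u|]. Its imaginary part is the principal argument of
    [u] shifted by a constant: minus [pi / 2] where [Im u > 0], plus [pi / 2] where [Im u < 0]. The
    derivative is thus the logarithmic derivative of [u]. *)
Lemma is_Cderive_log (s : R) (u : R -> R[i]) (du : R[i]) :
  complex.Im (u s) != 0 -> is_Cderive s u du ->
  is_Cderive s (fun x => half_plane_log (u x)) (du / u s).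
Proof.
move=> im0 [du1 du2].
have n0 : 0 < complex.Re (u s) * complex.Re (u s) + complex.Im (u s) * complex.Im (u s).
  by rewrite ltr_wpDl// -expr2 ?sqr_ge0// exprn_even_gt0.
have dn := is_deriveD (is_deriveM du1 du1) (is_deriveM du2 du2).
have nE : normc (u s) ^+ 2 = complex.Re (u s) * complex.Re (u s) +
   complex.Im (u s) * complex.Im (u s) by rewrite normc_sqr.
split => /=.
  have dl := is_derive1_comp (g := fun x => complex.Re (u x) * complex.Re (u x) +
    complex.Im (u x) * complex.Im (u x)) (is_derive1_ln n0) dn.
  apply: (is_derive_eq (is_deriveZ 2^-1 dl)).
  rewrite RecM RecV ImcV nE /GRing.scale/=.
  by move: (lt0r_neq0 n0) => {}n0; field.
have di := is_deriveV (f := fun x => complex.Im (u x)) im0 du2.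
have da := is_derive1_comp (g := fun x => complex.Re (u x) * (complex.Im (u x))^-1)
  (is_derive1_atan _) (is_deriveM du1 di).
apply: (is_derive_eq (is_deriveN da)).
rewrite ImcM RecV ImcV nE /GRing.scale/=.
have e : 1 + (complex.Re (u s) / complex.Im (u s)) ^+ 2 =
  (complex.Re (u s) * complex.Re (u s) + complex.Im (u s) * complex.Im (u s)) /
  (complex.Im (u s)) ^+ 2 by field.
rewrite e; move: (lt0r_neq0 n0) => {}n0; field.
by apply/andP; split.
Qed.

End log_primitive.

(** * Half-circles: comparison with the segment, bounds and limits *)

Section arcs.
Context {R : realType}.
Notation leb := (@lebesgue_measure R).
Implicit Types (z : R[i]) (e N t : R).

(* For [e = 1] (resp. [-1]) the lower (resp. upper) half of the circle of radius
   [N], run through from [-N] to [N]. *)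
Definition arc e N (s : R) : R[i] := (- N * cos s) +i* (- (e * N) * sin s).
Definition darc e N (s : R) : R[i] := (N * sin s) +i* (- (e * N) * cos s).

Lemma is_Cderive_arc e N s : is_Cderive s (arc e N) (darc e N s).
Proof.
apply: (is_Cderive_eq (is_Cderive_mk
  (is_deriveM (is_derive_cst (- N) s 1) (is_derive_cos s))
  (is_deriveM (is_derive_cst (- (e * N)) s 1) (is_derive_sin s)))).
by rewrite /darc /GRing.scale/=; congr (_ +i* _); ring.
Qed.

Lemma Cderivable_darc e N s : Cderivable s (darc e N).
Proof.
exact: (ex_intro _ _ (is_Cderive_mk
  (is_deriveM (is_derive_cst N s 1) (is_derive_sin s))
  (is_deriveM (is_derive_cst (- (e * N)) s 1) (is_derive_cos s)))).
Qed.

Lemma arc0 e N : arc e N 0 = (- N)%:C.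
Proof. by rewrite /arc cos0 sin0 mulr1 mulr0. Qed.

Lemma arcpi e N : arc e N pi = N%:C.
Proof. by rewrite /arc cospi sinpi mulr0 mulrN1 opprK. Qed.

(** Here and below, [e ^+ 2 = 1] expresses that [e] is 1 or -1, in a form that rewriting can use
    directly. *)
Lemma normc_arc e N s : e ^+ 2 = 1 -> 0 <= N -> normc (arc e N s) = N.
Proof.
move=> e1 N0; apply/eqP; rewrite -(@eqrXn2 _ 2)// ?normc_ge0// normc_sqr/=.
rewrite !exprMn !sqrrN exprMn e1 mul1r.
by rewrite -mulrDr cos2Dsin2 mulr1.
Qed.

(** For [e] equal to 1 or -1, the arc is [s |-> - N e^(i e s)], so differentiation multiplies it by
    [i e]. *)
Lemma darcE e N s : e ^+ 2 = 1 -> darc e N s = 'i%C * e%:C * arc e N s.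
Proof.
move=> e1; apply: complex_eqP => /=; last by ring.
transitivity (e ^+ 2 * (N * sin s)); [by rewrite e1 mul1r|ring].
Qed.

Lemma normc_darc e N s : e ^+ 2 = 1 -> 0 <= N -> normc (darc e N s) = N.
Proof.
move=> e1 N0; rewrite darcE// 2!normcM normci mul1r normcR normc_arc//.
suff -> : `|e| = 1 by rewrite mul1r.
by apply/eqP; rewrite -(@eqrXn2 _ 2)// real_normK ?num_real// e1 expr1n.
Qed.

Lemma normc_arcD e N s z : e ^+ 2 = 1 -> 0 <= N -> N - normc z <= normc (arc e N s + z).
Proof. by move=> e1 N0; rewrite -{1}(normc_arc s e1 N0) ge_normcB. Qed.

Definition cauchy_segment z N := fourier_cauchy z (fun s => s%:C) (fun=> 1) (- N) N.
Definition cauchy_arc z e N := fourier_cauchy z (arc e N) (darc e N) 0 pi.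

(** Both curves run from [-N] to [N], so [fourier_cauchy_sub] turns both sides into the same
    integral. *)
Lemma cauchy_segment_arc z e N t : complex.Im z != 0 -> e ^+ 2 = 1 -> normc z < N ->
  cexp (- 'i%C * z * t%:C) * cauchy_segment z N t - cauchy_segment z N 0 =
  cexp (- 'i%C * z * t%:C) * cauchy_arc z e N t - cauchy_arc z e N 0.
Proof.
move=> z0 e1 zN; have N0 : 0 < N by rewrite (le_lt_trans (normc_ge0 z)).
(* The maximum bounds both the position [s] and the constant velocity 1; the real axis stays at
   distance at least [|Im z|] from [-z]. *)
rewrite (@fourier_cauchy_sub _ _ _ _ _ _ (Num.max N 1) `|complex.Im z|); last 7 first.
- by rewrite gtrN.
- by move=> s; exact: is_Cderive_id.
- by move=> s; exact: Cderivable_cst.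
- by move=> s; rewrite -ler_norml => sN; rewrite normcR le_max sN.
- by move=> s _; rewrite normc1 le_max lexx orbT.
- by rewrite normr_gt0.
- by move=> s _; apply: le_trans (Im_le_normc _); rewrite ImcD/= add0r.
(* On the half-circle, position and velocity both have modulus [N], and the distance to [-z] is at
   least [N - |z|]. *)
rewrite (@fourier_cauchy_sub _ _ _ _ _ _ N (N - normc z)); last 7 first.
- exact: pi_gt0.
- exact: is_Cderive_arc.
- exact: Cderivable_darc.
- by move=> s _; rewrite normc_arc// ltW.
- by move=> s _; rewrite normc_darc// ltW.
- by rewrite subr_gt0.
- by move=> s _; apply: normc_arcD => //; exact: ltW.
by rewrite arc0 arcpi.
Qed.

(** The sign condition selects the half-circle in the half-plane opposite to the pole [-z].
    Translated by [z], both curves then avoid the real axis, and [half_plane_log] is a primitive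
    along each of them. *)
Lemma cauchy_segment_arc0 z e N : e ^+ 2 = 1 -> e * complex.Im z < 0 -> normc z < N ->
  cauchy_segment z N 0 = cauchy_arc z e N 0.
Proof.
move=> e1 ez zN; have N0 : 0 < N by rewrite (le_lt_trans (normc_ge0 z)).
have z0 : complex.Im z != 0 by apply: contraTneq ez => ->; rewrite mulr0 ltxx.
rewrite /cauchy_segment /cauchy_arc /fourier_cauchy.
under eq_Cintegral do rewrite mulr0 cexp0 mul1r.
under [RHS]eq_Cintegral do rewrite mulr0 cexp0 mul1r.
(* If this imaginary part vanished, multiplication by [e] would give [e Im z = N sin s >= 0]. *)
have im_arc s : 0 <= s <= pi -> complex.Im (arc e N s + z) != 0.
  move=> s0; rewrite ImcD/=; apply: contraTneq (sin_ge0_pi s0) => h.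
  have : e * (- (e * N) * sin s + complex.Im z) = 0 by rewrite h mulr0.
  rewrite mulrDr mulrA mulrN mulrA -expr2 e1 mul1r mulNr -ltNge.
  move=> /eqP; rewrite addrC subr_eq0 => /eqP E.
  by rewrite -(pmulr_rlt0 _ N0) -E.
rewrite (Cintegral_FTC (F := fun s => half_plane_log (s%:C + z))) ?gtrN//; last 2 first.
- move=> s _; rewrite -[1]addr0; apply: is_Cderive_log; first by rewrite ImcD/= add0r.
  by apply: is_CderiveD; [exact: is_Cderive_id|exact: is_Cderive_cst].
- move=> s _; apply: CderivableM; first exact: Cderivable_cst.
  apply: CderivableV.
    by apply: contraNneq z0 => /(congr1 (@complex.Im R)); rewrite ImcD/= add0r => ->.
  by apply: CderivableD; [exact: Cderivable_id|exact: Cderivable_cst].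
rewrite (Cintegral_FTC (F := fun s => half_plane_log (arc e N s + z))) ?pi_gt0//; last 2 first.
- move=> s s0; rewrite -[darc _ _ _]addr0; apply: is_Cderive_log; first exact: im_arc.
  by apply: is_CderiveD; [exact: is_Cderive_arc|exact: is_Cderive_cst].
- move=> s s0; apply: CderivableM; first exact: Cderivable_darc.
  apply: CderivableV.
    by apply: contraNneq (im_arc s s0) => ->.
  by apply: CderivableD; [exists (darc e N s); exact: is_Cderive_arc|exact: Cderivable_cst].
by rewrite arc0 arcpi.
Qed.

Lemma Cmeasurable_cauchy_arc z e N t : Cmeasurable (setT : set (measurableTypeR R))
  (fun s => cexp (- 'i%C * arc e N s * t%:C) * (darc e N s / (arc e N s + z))).
Proof.
have marc : Cmeasurable (setT : set (measurableTypeR R)) (arc e N).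
  by apply: Cderivable_measurable => s; exists (darc e N s); exact: is_Cderive_arc.
have mdarc : Cmeasurable (setT : set (measurableTypeR R)) (darc e N).
  by apply: Cderivable_measurable => s; exact: Cderivable_darc.
apply: CmeasurableM.
  apply: Cmeasurable_exp; apply: CmeasurableM; last exact: Cmeasurable_cst.
  by apply: CmeasurableM => //; exact: Cmeasurable_cst.
by apply: CmeasurableM => //; apply: CmeasurableV; apply: CmeasurableD => //.
Qed.

(** The threshold on [N] makes [N] positive and [N - |z| >= N / 2], so the quotient has modulus at
    most 2; the real part of [-i w t] on the arc is [- e t N sin s]. *)
Lemma normc_cauchy_arc_integrand z e N t s : e ^+ 2 = 1 -> 2 * normc z + 1 <= N ->
  normc (cexp (- 'i%C * arc e N s * t%:C) * (darc e N s / (arc e N s + z))) <=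
  2 * expR (- (e * t * sin s * N)).
Proof.
move=> e1 zN; have z0 := normc_ge0 z; have N0 : 0 < N by lra.
rewrite normcM normc_cexp normcM normcV [leLHS]mulrC.
rewrite ler_pM ?mulr_ge0 ?invr_ge0 ?normc_ge0 ?expR_ge0//.
  rewrite (normc_darc s e1 (ltW N0)) ler_pdivrMr; last first.
    by apply: lt_le_trans (normc_arcD s z e1 (ltW N0)); lra.
  by apply: le_trans (ler_wpM2l _ (normc_arcD s z e1 (ltW N0))) => //; lra.
rewrite ler_expR le_eqVlt; apply/orP; left; apply/eqP.
by rewrite /arc !RecM !ImcM /=; ring.
Qed.

Lemma normc_cauchy_arc_le z e N t : e ^+ 2 = 1 -> 2 * normc z + 1 <= N -> 0 <= e * t ->
  normc (cauchy_arc z e N t) <= 4 * pi.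
Proof.
move=> e1 zN et.
have z0 := normc_ge0 z; have N0 : 0 < N by lra.
apply: le_trans (normc_Cintegral_le (M := 2) _ _ _ _) _.
- exact: measurable_itv.
- exact: lebesgue_itvcc_fin.
- have [m1 m2] := Cmeasurable_cauchy_arc z e N t.
  by split; exact: measurable_funTS.
- move=> s /=; rewrite in_itv/= => s0.
  rewrite (le_trans (normc_cauchy_arc_integrand _ _ e1 zN))//.
  rewrite -[leRHS]mulr1 ler_wpM2l// -expR0 ler_expR oppr_le0.
  exact: mulr_ge0 (mulr_ge0 et (sin_ge0_pi s0)) (ltW N0).
- by rewrite fine_lebesgue_itvcc ?pi_ge0// subr0 mulrA -natrM.
Qed.

(** By [darcE] the integrand is [i e w / (w + z)] with [w] on the arc, that is [i e] minus the error
    term [i e z / (w + z)], which is [O(1 / N)]. *)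
Lemma cvg_cauchy_arc0 z e (N : R^nat) : e ^+ 2 = 1 ->
  (forall n, 2 * normc z + 1 <= N n) -> N n @[n --> \oo] --> +oo ->
  cauchy_arc z e (N n) 0 @[n --> \oo] --> 'i%C * (e * pi)%:C.
Proof.
move=> e1 zN Noo.
have z0 := normc_ge0 z.
have e1' : `|e| = 1.
  by apply/eqP; rewrite -(@eqrXn2 _ 2)// real_normK ?num_real// e1 expr1n.
(* The error term has modulus at most [2 |z| / N] on an interval of length [pi]; another factor 2
   comes from [normc_Cintegral_le]. *)
apply: (@cvg_normc_le _ _ _ _ _ _ (fun n => (4 * normc z * pi) * (N n)^-1)); last first.
  rewrite -[X in _ --> X](mulr0 (4 * normc z * pi)); apply: cvgMr.
  apply/gtr0_cvgV0 => //; apply: nearW => n; have := zN n; lra.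
apply: nearW => n; have N0 : 0 < N n by have := zN n; lra.
have Nz : N n / 2 <= N n - normc z by have := zN n; lra.
have mpi : measurable (`[0, pi] : set (measurableTypeR R)) by exact: measurable_itv.
have pifin := @lebesgue_itvcc_fin R 0 pi.
have -> : cauchy_arc z e (N n) 0 - 'i%C * (e * pi)%:C =
    Cintegral leb `[0, pi] (fun s => - ('i%C * e%:C * z) / (arc e (N n) s + z)).
  have -> : 'i%C * (e * pi)%:C = Cintegral leb `[0, pi] (fun=> 'i%C * e%:C).
    by apply: complex_eqP;
      rewrite /= Rintegral_cst// fine_lebesgue_itvcc ?pi_ge0//; ring.
  rewrite /cauchy_arc /fourier_cauchy -CintegralB//; last 2 first.
  - apply: (@Cintegrable_bounded _ _ _ _ _ _ 2) => //.
      have [m1 m2] := Cmeasurable_cauchy_arc z e (N n) 0.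
      by split; exact: measurable_funTS.
    move=> s _; rewrite (le_trans (normc_cauchy_arc_integrand _ _ e1 (zN n)))//.
    by rewrite mulr0 !mul0r oppr0 expR0 mulr1.
  - apply: (@Cintegrable_bounded _ _ _ _ _ _ 1) => //.
    by move=> s _; rewrite normcM normci normcR e1' mulr1.
  apply: eq_Cintegral => s _; rewrite mulr0 cexp0 mul1r darcE//.
  have u0 : arc e (N n) s + z != 0.
    rewrite -normc_eq0 gt_eqF// (lt_le_trans _ (normc_arcD s z e1 (ltW N0)))//.
    by rewrite (lt_le_trans _ Nz)// divr_gt0.
  by field.
apply: le_trans (normc_Cintegral_le (M := 2 * normc z * (N n)^-1) _ _ _ _) _ => //.
- apply: CmeasurableM; first exact: Cmeasurable_cst.
  apply: CmeasurableV; apply: CmeasurableD; last exact: Cmeasurable_cst.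
  have [m1 m2] : Cmeasurable (setT : set (measurableTypeR R)) (arc e (N n)).
    by apply: Cderivable_measurable => s; exists (darc e (N n) s); exact: is_Cderive_arc.
  by split; exact: measurable_funTS.
- move=> s _; rewrite normcM normcN !normcM normci normcR e1' !mul1r normcV.
  rewrite (mulrC 2) -mulrA ler_wpM2l// -[2]invrK -invfM lef_pV2 ?posrE//.
  + by rewrite mulrC (le_trans Nz)// normc_arcD// ltW.
  + by rewrite (lt_le_trans _ (normc_arcD s z e1 (ltW N0)))// (lt_le_trans _ Nz)// divr_gt0.
  + by rewrite mulr_gt0// invr_gt0.
rewrite fine_lebesgue_itvcc ?pi_ge0// subr0.
by rewrite le_eqVlt; apply/orP; left; apply/eqP; ring.
Qed.

(** Dominated convergence replaces the explicit estimate of Jordan's lemma: the integrand is bounded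
    by 2 and decays exponentially wherever [sin s > 0]. *)
Lemma cvg_cauchy_arc z e t (N : R^nat) : e ^+ 2 = 1 -> 0 < e * t ->
  (forall n, 2 * normc z + 1 <= N n) -> N n @[n --> \oo] --> +oo ->
  cauchy_arc z e (N n) t @[n --> \oo] --> (0 : R[i]).
Proof.
move=> e1 et zN Noo.
have mpi : measurable (`[0, pi] : set (measurableTypeR R)) by exact: measurable_itv.
have pifin := @lebesgue_itvcc_fin R 0 pi.
have -> : (0 : R[i]) = Cintegral leb `[0, pi] (fun=> 0).
  by apply: complex_eqP; rewrite /= Rintegral_cst// mul0r.
apply: (@Cintegral_dominated_cvg _ _ _ _ _ _ _ 2) => //.
- move=> n; have [m1 m2] := Cmeasurable_cauchy_arc z e (N n) t.
  by split; exact: measurable_funTS.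
(* The sine vanishes at the two end points, where there is no decay; they form a null set. *)
- exists [set 0; pi]; split.
  + by apply: measurableU; exact: measurable_set1.
  + apply: countable_lebesgue_measure0; apply: finite_set_countable.
    by rewrite finite_setU; split; exact: finite_set1.
  + move=> s /= /not_implyP[]; rewrite in_itv/= => /andP[s0 spi] ncv.
    apply: contrapT => /not_orP[/eqP s0' /eqP spi']; apply: ncv.
    have sins : 0 < sin s.
      by apply: sin_gt0_pi; rewrite !lt_neqAle eq_sym s0' s0 spi' spi.
    apply: (@cvg_normc_le _ _ _ _ _ _ (fun n => 2 * expR (- (e * t * sin s * N n)))).
      by apply: nearW => n; rewrite subr0; exact: normc_cauchy_arc_integrand.
    rewrite -[X in _ --> X](mulr0 2); apply: cvgMr.
    have c0 : 0 < e * t * sin s by rewrite mulr_gt0.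
    have cN : e * t * sin s * N n @[n --> \oo] --> +oo.
      apply/cvgryPge => A; have /cvgryPge/(_ (A / (e * t * sin s))) := Noo.
      by apply: filterS => n; rewrite ler_pdivrMr// mulrC.
    exact: (cvg_comp _ _ cN (@cvgr_expR R)).
- move=> n s /=; rewrite in_itv/= => s0.
  rewrite (le_trans (normc_cauchy_arc_integrand _ _ e1 (zN n)))//.
  rewrite -[leRHS]mulr1 ler_wpM2l// -expR0 ler_expR oppr_le0.
  have N0 : 0 <= N n by have := normc_ge0 z; have := zN n; lra.
  exact: mulr_ge0 (mulr_ge0 (ltW et) (sin_ge0_pi s0)) N0.
Qed.

End arcs.

(** * Uniform bound and pointwise limit of the truncated kernels *)

Section truncated_kernel.
Context {R : realType}.
Notation leb := (@lebesgue_measure R).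
Implicit Types (z : R[i]) (N t : R).

(** The exponential of the Carleman transform, cut to the open half-line on which it decays; the
    value 1/2 at 0 transfers the halving of the atom from the measure to the integrand. *)
Definition half_line_exp z t : R[i] :=
  if 0 < t * complex.Im z then cexp ('i%C * t%:C * z)
  else if t == 0 then (2^-1)%:C else 0.

(** This is the pointwise limit of [cauchy_segment z N] as [N] grows, by [cvg_cauchy_segment]. *)
Definition limit_kernel z t : R[i] :=
  (- (2 * pi * Num.sg (complex.Im z)))%:C * 'i%C * half_line_exp z t.

Lemma normc_exp_half_line z t : 0 <= t * complex.Im z ->
  normc (cexp ('i%C * t%:C * z)) <= 1.
Proof.
move=> tz; rewrite normc_cexp -[leRHS]expR0 ler_expR.
rewrite (_ : complex.Re _ = - (t * complex.Im z)) ?oppr_le0//.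
by rewrite !RecM !ImcM /=; ring.
Qed.

Lemma sgr_sqr (x : R) : x != 0 -> Num.sg x ^+ 2 = 1.
Proof. by rewrite sqr_sg => ->. Qed.

(** This is [cauchy_segment_arc] solved for the segment: [e^(i t z)] is the inverse of the factor
    [e^(-i z t)]. *)
Lemma cauchy_segmentE z e N t : complex.Im z != 0 -> e ^+ 2 = 1 -> normc z < N ->
  cauchy_segment z N t = cauchy_arc z e N t +
    cexp ('i%C * t%:C * z) * (cauchy_segment z N 0 - cauchy_arc z e N 0).
Proof.
move=> z0 e1 zN; have := cauchy_segment_arc t z0 e1 zN.
have -> : - 'i%C * z * t%:C = - ('i%C * t%:C * z) by ring.
have := cexpNK ('i%C * t%:C * z).
move: (cexp _) (cexp _) => E' E EE' h.
have {}h : E' * cauchy_segment z N t = E' * cauchy_arc z e N t +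
    (cauchy_segment z N 0 - cauchy_arc z e N 0).
  by apply/eqP; rewrite addrCA addrC -subr_eq h.
have := congr1 (fun x => E * x) h.
by rewrite mulrDr !mulrA EE' !mul1r.
Qed.

(** The half-circle is chosen so that [e t >= 0]. When it goes round the pole, the correction term
    carries [e^(i t z)], of modulus at most 1 in that case; otherwise the correction vanishes. *)
Lemma normc_cauchy_segment_le z N t : complex.Im z != 0 -> 2 * normc z + 1 <= N ->
  normc (cauchy_segment z N t) <= 12 * pi.
Proof.
move=> z0 zN; have n0 := normc_ge0 z.
have zN' : normc z < N by lra.
have s1 := sgr_sqr z0; have sN1 : (- Num.sg (complex.Im z)) ^+ 2 = 1 by rewrite sqrrN.
have sz : 0 < Num.sg (complex.Im z) * complex.Im z by rewrite -normrEsg normr_gt0.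
have seg0 := @cauchy_segment_arc0 _ z (- Num.sg (complex.Im z)) N sN1.
rewrite mulNr oppr_lt0 in seg0; have {}seg0 := seg0 sz zN'.
(* Thus [t Im z] has the sign of [e t] for [e = sgn(Im z)], which is the quantity that the arc
   estimates require. *)
have st : t * complex.Im z = `|complex.Im z| * (Num.sg (complex.Im z) * t).
  by rewrite {1}[complex.Im z]numEsg; ring.
have pi0 := pi_ge0 R.
have [tz|tz] := leP 0 (t * complex.Im z).
  have st0 : 0 <= Num.sg (complex.Im z) * t.
    by rewrite st pmulr_rge0 ?normr_gt0 in tz.
  rewrite (cauchy_segmentE t z0 s1 zN') seg0.
  (* One arc integral at [t] and two at 0, each at most [4 pi]. *)
  have -> : 12 * pi = 4 * pi + 1 * (4 * pi + 4 * pi) :> R by ring.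
  rewrite (le_trans (le_normcD _ _))// lerD ?normc_cauchy_arc_le//.
  rewrite normcM ler_pM ?normc_ge0 ?normc_exp_half_line//.
  rewrite (le_trans (le_normcD _ _))// [normc (- _)]normcN.
  by rewrite lerD// normc_cauchy_arc_le// mulr0.
rewrite (cauchy_segmentE t z0 sN1 zN') seg0 subrr mulr0 addr0.
rewrite (le_trans (normc_cauchy_arc_le sN1 zN _))//.
  rewrite mulNr oppr_ge0 ltW//.
  by rewrite st pmulr_rlt0 ?normr_gt0 in tz.
by rewrite ler_wpM2r// ler_nat.
Qed.

Lemma cvg_cauchy_segment z t (N : R^nat) : complex.Im z != 0 ->
  (forall n, 2 * normc z + 1 <= N n) -> N n @[n --> \oo] --> +oo ->
  cauchy_segment z (N n) t @[n --> \oo] --> limit_kernel z t.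
Proof.
move=> z0 zN Noo; have n0 := normc_ge0 z.
have zN' n : normc z < N n by have := zN n; lra.
have s1 := sgr_sqr z0; have sN1 : (- Num.sg (complex.Im z)) ^+ 2 = 1 by rewrite sqrrN.
have sz : 0 < Num.sg (complex.Im z) * complex.Im z by rewrite -normrEsg normr_gt0.
have seg0 n : cauchy_segment z (N n) 0 = cauchy_arc z (- Num.sg (complex.Im z)) (N n) 0.
  by apply: cauchy_segment_arc0 => //; rewrite mulNr oppr_lt0.
have st : t * complex.Im z = `|complex.Im z| * (Num.sg (complex.Im z) * t).
  by rewrite {1}[complex.Im z]numEsg; ring.
have c1 := cvg_cauchy_arc0 s1 zN Noo.
have cN1 := cvg_cauchy_arc0 sN1 zN Noo.
rewrite /limit_kernel /half_line_exp; have [tz|tz|tz] := ltgtP 0 (t * complex.Im z).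
(* The half-circle with [e = sgn(Im z)] goes round the pole: its integral at [t] vanishes in the
   limit, and the difference of the two limits at 0 produces [- 2 pi i sgn(Im z)]. *)
- have st0 : 0 < Num.sg (complex.Im z) * t.
    by rewrite st pmulr_rgt0 ?normr_gt0 in tz.
  under eq_fun do rewrite (cauchy_segmentE t z0 s1)// seg0.
  have c0 := cvg_cauchy_arc s1 st0 zN Noo.
  have -> : (- (2 * pi * Num.sg (complex.Im z)))%:C * 'i%C * cexp ('i%C * t%:C * z) =
      0 + cexp ('i%C * t%:C * z) * ('i%C * (- Num.sg (complex.Im z) * pi)%:C -
        'i%C * (Num.sg (complex.Im z) * pi)%:C).
    rewrite add0r [RHS]mulrC -mulrBr -rmorphB/= [X in X * cexp _]mulrC.
    by congr (_ * _%:C * _); ring.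
  exact: cvgD c0 (cvgMr (cvgB cN1 c1)).
(* The opposite half-circle now has [e t > 0] and does not go round the pole, so no correction
   remains. *)
- have -> : (t == 0) = false.
    by apply/negbTE; apply: contraTneq tz => ->; rewrite mul0r ltxx.
  rewrite mulr0; under eq_fun do rewrite (cauchy_segmentE t z0 sN1)// seg0 subrr mulr0 addr0.
  apply: cvg_cauchy_arc => //; rewrite mulNr oppr_gt0.
  by rewrite st pmulr_rlt0 ?normr_gt0 in tz.
(* At [t = 0] only the limit of a single half-circle is left, half of the jump found in the first
   case. *)
- have -> : t = 0 by apply/eqP; move/esym/eqP: tz; rewrite mulf_eq0 (negbTE z0) orbF.
  rewrite eqxx; under eq_fun do rewrite seg0.
  have -> : (- (2 * pi * Num.sg (complex.Im z)))%:C * 'i%C * (2^-1)%:C =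
      'i%C * (- Num.sg (complex.Im z) * pi)%:C.
    by rewrite mulrAC -rmorphM/= mulrC; congr (_ * _%:C); field.
  exact: cN1.
Qed.

Lemma Cmeasurable_half_line_exp z :
  Cmeasurable (setT : set (measurableTypeR R)) (half_line_exp z).
Proof.
apply: Cmeasurable_ifT.
- by apply: measurable_fun_ltr => //; exact: measurable_funM.
- apply: Cmeasurable_exp; apply: CmeasurableM; last exact: Cmeasurable_cst.
  apply: CmeasurableM; first exact: Cmeasurable_cst.
  by apply: CmeasurableR; exact: measurable_id.
- apply: Cmeasurable_ifT; [exact: measurable_fun_eqr|exact: Cmeasurable_cst..].
Qed.

Lemma Cmeasurable_limit_kernel z :
  Cmeasurable (setT : set (measurableTypeR R)) (limit_kernel z).
Proof.
apply: CmeasurableM; first exact: Cmeasurable_cst.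
exact: Cmeasurable_half_line_exp.
Qed.

End truncated_kernel.

(** * Principal value integral of the Fourier transform of a measure *)

Section finite_measure_transform.
Context {R : realType}.
Notation leb := (@lebesgue_measure R).
Variable z : R[i].
Hypothesis z0 : complex.Im z != 0.

(** Existence and value of the principal value are kept in one relation, so that linearity follows
    from limit rules without handling [lim]. *)
Definition VP_cvg (f : R -> R[i]) (l : R[i]) :=
  (forall N : R, Cintegrable leb `[- N, N] f) /\
  (Cintegral leb `[- N, N] f @[N --> +oo] --> l).

Lemma VP_cvgZ c f l : VP_cvg f l -> VP_cvg (fun x => c * f x) (c * l).
Proof.
move=> [fi fl]; split=> [N|]; first by apply: CintegrableZl => //; exact: measurable_itv.
under eq_fun do rewrite CintegralZl//.
exact: (cvgMr fl).
Qed.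

Lemma VP_cvgD f g l k : VP_cvg f l -> VP_cvg g k -> VP_cvg (fun x => f x + g x) (l + k).
Proof.
move=> [fi fl] [gi gk]; split=> [N|]; first by apply: CintegrableD => //; exact: measurable_itv.
under eq_fun do rewrite CintegralD//.
by have h := cvgD fl gk; exact: h.
Qed.

Lemma VP_cvg_eq f g l k : f =1 g -> l = k -> VP_cvg f l -> VP_cvg g k.
Proof. by move=> /funext -> ->. Qed.

Lemma VP_cvgP f l : VP_cvg f l -> VP_exists f /\ VP_integral f = l.
Proof.
move=> [fi fl]; split; first by split; [exact: fi|apply/cvg_ex; exists l; exact: fl].
apply: cvg_lim; [exact: norm_hausdorff|exact: fl].
Qed.

Section finite_measure.
Variable nu : {finite_measure set (measurableTypeR R) -> \bar R}.

(** The first variable is the frequency and the second the point of the measure; the numerator 1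
    makes integration in the first variable literally [cauchy_segment]. *)
Let Fint (p : measurableTypeR R * measurableTypeR R) : R[i] :=
  cexp (- 'i%C * p.1%:C * p.2%:C) * (1 / (p.1%:C + z)).

Let mFint : Cmeasurable setT Fint.
Proof.
apply: CmeasurableM.
  apply: Cmeasurable_exp; apply: CmeasurableM.
    apply: CmeasurableM; first exact: Cmeasurable_cst.
    by apply: CmeasurableR; exact: measurable_fst.
  by apply: CmeasurableR; exact: measurable_snd.
apply: CmeasurableM; first exact: Cmeasurable_cst.
apply: CmeasurableV; apply: CmeasurableD; last exact: Cmeasurable_cst.
by apply: CmeasurableR; exact: measurable_fst.
Qed.

(** The exponential has modulus 1 at real arguments, and [|x + z| >= |Im z|] for real [x]. *)
Let normc_Fint p : normc (Fint p) <= `|complex.Im z|^-1.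
Proof.
rewrite /Fint normcM normc_cexp normcM normc1 mul1r normcV -[leRHS]mul1r.
rewrite ler_pM ?expR_ge0 ?invr_ge0 ?normc_ge0//.
  by rewrite -[leRHS]expR0 ler_expR !RecM !ImcM /= !(mul0r, mulr0, oppr0, addr0, subr0).
have h : `|complex.Im z| <= normc (p.1%:C + z).
  by apply: le_trans (Im_le_normc _); rewrite ImcD/= add0r.
by rewrite lef_pV2 ?posrE// ?normr_gt0// (lt_le_trans _ h)// normr_gt0.
Qed.

Let mN (N : R) : measurable (`[- N, N] : set (measurableTypeR R)).
Proof. exact: measurable_itv. Qed.

Let nufin : (nu setT < +oo)%E.
Proof. by rewrite -ge0_fin_numE//; exact: fin_num_measure. Qed.

(** Measurability in [t] is read off from the integrability of a partial integral in Fubini's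
    theorem. *)
Lemma Cmeasurable_cauchy_segment N :
  Cmeasurable (setT : set (measurableTypeR R)) (cauchy_segment z N).
Proof.
have mF' := Cmeasurable_swap mFint.
have [[i1 i2] _] := Cintegral_Fubini_bounded measurableT (mN N) nufin
  (lebesgue_itvcc_fin (- N) N) mF' (fun x y _ _ => normc_Fint (y, x)).
by split; apply/measurable_EFinP; [exact: measurable_int i1|exact: measurable_int i2].
Qed.

Lemma fourier_transform_Fubini N :
  Cintegrable leb `[- N, N] (fun x : R =>
    Cintegral nu setT (fun t : R => cexp (- 'i%C * x%:C * t%:C)) / (x%:C + z)) /\
  Cintegral leb `[- N, N] (fun x : R =>
    Cintegral nu setT (fun t : R => cexp (- 'i%C * x%:C * t%:C)) / (x%:C + z)) =
  Cintegral nu setT (cauchy_segment z N).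
Proof.
have [i e] := Cintegral_Fubini_bounded (mN N) measurableT
  (lebesgue_itvcc_fin (- N) N) nufin mFint (fun x y _ _ => normc_Fint (x, y)).
have E (x : R) : Cintegral nu setT (fun t : R => cexp (- 'i%C * x%:C * t%:C)) / (x%:C + z) =
    Cintegral nu setT (fun t => Fint (x, t)).
  rewrite -CintegralZr//.
    by apply: eq_Cintegral => t _; rewrite /Fint/= mul1r.
  apply: (@Cintegrable_bounded _ _ _ _ _ _ 1) => //.
    apply: Cmeasurable_exp; apply: CmeasurableM; first exact: Cmeasurable_cst.
    by apply: CmeasurableR; exact: measurable_id.
  move=> t _; rewrite normc_cexp -[leRHS]expR0 ler_expR !RecM !ImcM /=.
  by rewrite !(mul0r, mulr0, oppr0, addr0, subr0).
rewrite (_ : (fun x : R => _ / _) =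
    (fun x : R => Cintegral nu setT (fun t => Fint (x, t)))); last exact/funext.
split; [exact: i|exact: e].
Qed.

Lemma cvg_Cintegral_cauchy_segment :
  Cintegral nu setT (cauchy_segment z N) @[N --> +oo] -->
  Cintegral nu setT (limit_kernel z).
Proof.
have key (u : R^nat) : u n @[n --> \oo] --> +oo ->
    Cintegral nu setT (cauchy_segment z (u n)) @[n --> \oo] -->
    Cintegral nu setT (limit_kernel z).
  (* The uniform bound holds only above the threshold, so the sequence is first raised to it; it is
     eventually unchanged. *)
  move=> uoo; pose N n := Num.max (u n) (2 * normc z + 1).
  have zN n : 2 * normc z + 1 <= N n by rewrite le_max lexx orbT.
  have Noo : N n @[n --> \oo] --> +oo.
    apply/cvgryPge => A; have /cvgryPge/(_ A) := uoo.
    by apply: filterS => n An; rewrite le_max An.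
  have : Cintegral nu setT (cauchy_segment z (N n)) @[n --> \oo] -->
      Cintegral nu setT (limit_kernel z).
    apply: (@Cintegral_dominated_cvg _ _ _ _ _ _ _ (12 * pi)) => //.
    - by move=> n; exact: Cmeasurable_cauchy_segment.
    - exact: Cmeasurable_limit_kernel.
    - by apply: aeW => t _; exact: cvg_cauchy_segment.
    - by move=> n t _; exact: normc_cauchy_segment_le.
  apply: cvg_trans; apply: near_eq_cvg.
  have /cvgryPge/(_ (2 * normc z + 1)) := uoo.
  by apply: filterS => n h; rewrite /N max_l.
(* The limit along real [N] is reduced to sequences, for which dominated convergence is available,
   one component at a time. *)
apply: cvg_Re_Im.
  by apply/cvg_pinftyP => u /key/cvg_Re.
by apply/cvg_pinftyP => u /key/cvg_Im.
Qed.

Lemma VP_cvg_finite_measure :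
  VP_cvg (fun x : R =>
      Cintegral nu setT (fun t : R => cexp (- 'i%C * x%:C * t%:C)) / (x%:C + z))
    (Cintegral nu setT (limit_kernel z)).
Proof.
split=> [N|]; first by case: (fourier_transform_Fubini N).
under eq_fun do rewrite (fourier_transform_Fubini _).2.
exact: cvg_Cintegral_cauchy_segment.
Qed.

End finite_measure.

Lemma VP_cvg_fourier (mu : complex_measure (measurableTypeR R) R) :
  VP_cvg (fun x : R => fourier mu x / (x%:C + z))
    (((Num.sqrt (2 * pi))^-1)%:C * cmeas_integral mu setT (limit_kernel z)).
Proof.
have chargeP (nu : {charge set (measurableTypeR R) -> \bar R}) :
    VP_cvg (fun x : R =>
      charge_integral nu setT (fun t : R => cexp (- 'i%C * x%:C * t%:C)) / (x%:C + z))
    (charge_integral nu setT (limit_kernel z)).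
  have h1 := VP_cvg_finite_measure (jordan_pos (Hahn_pos_neg nu)).
  have h2 := VP_cvg_finite_measure (jordan_neg (Hahn_pos_neg nu)).
  apply: VP_cvg_eq (VP_cvgD h1 (VP_cvgZ (-1) h2)).
    by move=> x; rewrite mulN1r -mulrBl.
  by rewrite mulN1r.
have h1 := chargeP (cmeas_Re mu); have h2 := chargeP (cmeas_Im mu).
apply: VP_cvg_eq (VP_cvgZ ((Num.sqrt (2 * pi))^-1)%:C (VP_cvgD h1 (VP_cvgZ 'i%C h2))).
  by move=> x; rewrite /fourier /cmeas_integral [X in _ * (_ + X)]mulrA -mulrDl mulrA.
by [].
Qed.

End finite_measure_transform.

(** * The Carleman transform as an integral with respect to the measure itself *)

Section cmeas_integral_theory.
Context d (T : measurableType d) (R : realType).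
Implicit Types (mu : complex_measure T R) (nu : {charge set T -> \bar R}).
Implicit Types (m : {finite_measure set T -> \bar R}) (D : set T) (f g : T -> R[i]).

(** All measures below are finite, so this one condition gives integrability for every Jordan part
    at once. *)
Definition Cbounded D f := Cmeasurable D f /\ exists M, forall x, D x -> normc (f x) <= M.

Lemma Cbounded_integrable m D f : measurable D -> Cbounded D f -> Cintegrable m D f.
Proof.
move=> mD [mf [M fM]]; apply: (Cintegrable_bounded mD _ mf fM).
by rewrite -ge0_fin_numE//; exact: fin_num_measure.
Qed.

Lemma Rintegral_measure_add m1 m2 D (f : T -> R) : measurable D ->
  m1.-integrable D (EFin \o f) -> m2.-integrable D (EFin \o f) ->
  \int[measure_add m1 m2]_(x in D) f x =
  \int[m1]_(x in D) f x + \int[m2]_(x in D) f x.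
Proof.
move=> mD i1 i2; rewrite /Rintegral (integral_measure_add mD i1 i2).
by rewrite fineD//; exact: integrable_fin_num.
Qed.

Lemma Cintegral_measure_add m1 m2 D f : measurable D ->
  Cintegrable m1 D f -> Cintegrable m2 D f ->
  Cintegral (measure_add m1 m2) D f = Cintegral m1 D f + Cintegral m2 D f.
Proof.
by move=> mD [i1 j1] [i2 j2]; apply: complex_eqP; rewrite /= Rintegral_measure_add.
Qed.

Lemma jordanE nu A : measurable A ->
  nu A = (jordan_pos (Hahn_pos_neg nu) A - jordan_neg (Hahn_pos_neg nu) A)%E.
Proof.
by move=> mA; rewrite (jordan_decomp (Hahn_pos_neg nu) mA) /cadd /= cscaleN1.
Qed.

(** The Hahn decompositions of the two charges are chosen independently, so their Jordan parts are
    not compared one by one. Moving the negative parts across leaves an equality between two sums of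
    positive measures on subsets of [D]. *)
Lemma eq_charge_integral nu1 nu2 D f : measurable D -> Cbounded D f ->
  (forall A, measurable A -> A `<=` D -> nu1 A = nu2 A) ->
  charge_integral nu1 D f = charge_integral nu2 D f.
Proof.
move=> mD bf e; rewrite /charge_integral.
have i m := @Cbounded_integrable m D f mD bf.
apply/eqP; rewrite subr_eq addrAC eq_sym subr_eq eq_sym; apply/eqP.
rewrite -!Cintegral_measure_add//.
rewrite /Cintegral /Rintegral.
have E A : measurable A -> A `<=` D ->
    measure_add (jordan_pos (Hahn_pos_neg nu1)) (jordan_neg (Hahn_pos_neg nu2)) A =
    measure_add (jordan_pos (Hahn_pos_neg nu2)) (jordan_neg (Hahn_pos_neg nu1)) A.
  move=> mA AD; rewrite !measure_addE.
  (* Finiteness of all four values allows the rearrangement in the extended reals. *)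
  have alg (a b p q : \bar R) : a \is a fin_num -> b \is a fin_num ->
      p \is a fin_num -> q \is a fin_num ->
      (a - b = p - q -> a + q = p + b)%E.
    move: a b p q => [a||] [b||] [p||] [q||] //= _ _ _ _ /(congr1 fine) /= h.
    by congr (_%:E); lra.
  have e' := e A mA AD; rewrite (jordanE nu1 mA) (jordanE nu2 mA) in e'.
  by apply: alg e'; exact: fin_num_measure.
by rewrite !(eq_measure_integral _ E).
Qed.

Lemma eq_cmeas_integral_measure mu1 mu2 D f : measurable D -> Cbounded D f ->
  (forall A, measurable A -> A `<=` D -> mu1 A = mu2 A) ->
  cmeas_integral mu1 D f = cmeas_integral mu2 D f.
Proof.
move=> mD bf e; rewrite /cmeas_integral; congr (_ + _ * _);
  by apply: eq_charge_integral => // A mA AD; rewrite /= /cmeas_Re /cmeas_Im e.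
Qed.

Lemma eq_cmeas_integral mu D f g : {in D, f =1 g} ->
  cmeas_integral mu D f = cmeas_integral mu D g.
Proof.
move=> fg; rewrite /cmeas_integral /charge_integral.
by congr (_ - _ + _ * (_ - _)); exact: eq_Cintegral.
Qed.

Lemma cmeas_integralZl mu D f c : measurable D -> Cbounded D f ->
  cmeas_integral mu D (fun x => c * f x) = c * cmeas_integral mu D f.
Proof.
move=> mD bf; rewrite /cmeas_integral /charge_integral.
rewrite !CintegralZl//; try exact: Cbounded_integrable.
by ring.
Qed.

Lemma cmeas_integral0 mu D : measurable D -> cmeas_integral mu D (fun=> 0) = 0.
Proof.
move=> mD; under eq_cmeas_integral do rewrite -[0](mul0r 0).
rewrite cmeas_integralZl ?mul0r//; split; first exact: Cmeasurable_cst.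
by exists 0 => x _; rewrite normc0.
Qed.

Lemma cmeas_integral_setU mu (A B : set T) f : measurable A -> measurable B ->
  Cbounded (A `|` B) f -> [disjoint A & B] ->
  cmeas_integral mu (A `|` B) f = cmeas_integral mu A f + cmeas_integral mu B f.
Proof.
move=> mA mB bf AB; rewrite /cmeas_integral /charge_integral.
have mAB := measurableU _ _ mA mB.
rewrite !Cintegral_setU//; try exact: Cbounded_integrable.
by ring.
Qed.

Lemma cmeas_integral_set1 mu (a : T) f : measurable [set a] ->
  cmeas_integral mu [set a] f = f a * mu [set a].
Proof.
move=> ma.
have C m : Cintegral m [set a] f = f a * (fine (m [set a]))%:C.
  have h (g : T -> R) : \int[m]_(x in [set a]) g x = g a * fine (m [set a]).
    rewrite -Rintegral_cst//; apply: eq_Rintegral => x; rewrite inE => ->.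
    by [].
  by apply: complex_eqP; rewrite /= ?RecM ?ImcM/= h mulr0 ?subr0 ?add0r.
have ch nu : charge_integral nu [set a] f = f a * (fine (nu [set a]))%:C.
  rewrite /charge_integral !C -mulrBr -rmorphB/= jordanE//.
  by rewrite fineB//; exact: fin_num_measure.
rewrite /cmeas_integral !ch /= mulrCA -mulrDr; congr (_ * _).
by rewrite -complexE.
Qed.

End cmeas_integral_theory.

(** * Both branches of the Carleman transform as one integral *)

Section carleman_transform.
Context {R : realType}.
Implicit Types (mu : complex_measure (measurableTypeR R) R) (z : R[i]).

Lemma halve_atom0_notin mu (A : set R) : ~ A 0 -> halve_atom0 mu A = mu A.
Proof. by move=> A0; rewrite /= indicE memNset// mulr0 addr0. Qed.

Lemma halve_atom0_set1 mu : halve_atom0 mu [set 0] = 2^-1 * mu [set 0].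
Proof. by rewrite /= indicE mem_set//= mulr1; field. Qed.

(** Here [P] and [Q] are to be the two open half-lines. On [P] the halved measure agrees with [mu];
    at 0, half the mass against the value 1 equals the full mass against 1/2; on [Q] the function
    [H] vanishes. *)
Lemma cmeas_integral_halve_atom0 mu (P Q : set (measurableTypeR R)) (E H : R -> R[i]) :
  measurable P -> measurable Q -> ~ P 0 -> ~ Q 0 -> P `&` Q = set0 ->
  [set 0] `|` P `|` Q = setT ->
  Cbounded ([set 0] `|` P) E -> Cbounded setT H ->
  E 0 = 1 -> H 0 = 2^-1 -> {in P, E =1 H} -> {in Q, H =1 (fun=> 0)} ->
  cmeas_integral (halve_atom0 mu) ([set 0] `|` P) E = cmeas_integral mu setT H.
Proof.
move=> mP mQ P0 Q0 PQ PQT bE bH E0 H0 EH HQ.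
have m0 : measurable ([set 0] : set (measurableTypeR R)) by exact: measurable_set1.
have m0P := measurableU _ _ m0 mP.
have bS (A B : set (measurableTypeR R)) F : measurable B -> A `<=` B ->
    Cbounded B F -> Cbounded A F.
  move=> mB AB [[m1 m2] [M FM]]; split; last by exists M => x /AB; exact: FM.
  by split; exact: (measurable_funS mB AB).
have d0P : [disjoint [set 0] & P].
  by apply/disj_setPS => x [/= ->].
rewrite -PQT (cmeas_integral_setU mu m0P mQ); last 2 first.
- by rewrite PQT.
- apply/disj_setPS => x [/= [->|Px] Qx]; first exact: Q0.
  by have : (P `&` Q) x by []; rewrite PQ.
rewrite !(cmeas_integral_setU _ m0 mP)//; last by apply: bS bH.
rewrite (eq_cmeas_integral mu HQ) cmeas_integral0// addr0.
rewrite !cmeas_integral_set1// halve_atom0_set1 E0 H0 mul1r; congr (_ + _).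
rewrite -(eq_cmeas_integral mu EH); apply: eq_cmeas_integral_measure => //.
  by apply: bS bE => // x; right.
move=> A mA AP; apply: halve_atom0_notin.
by move=> /AP.
Qed.

Lemma Cbounded_half_line_exp z :
  Cbounded (setT : set (measurableTypeR R)) (half_line_exp z).
Proof.
split; first exact: Cmeasurable_half_line_exp.
exists 1 => t _; rewrite /half_line_exp.
case: ifPn => [tz|_]; first by rewrite normc_exp_half_line// ltW.
case: ifP => _; last by rewrite normc0.
by rewrite normcR ger0_norm ?invr_ge0// invf_le1// ler1n.
Qed.

(** The sign of [Im z] absorbs the minus sign of the lower branch, and [half_line_exp] selects the
    half-line of either branch. *)
Lemma carlemanE mu z : complex.Im z != 0 ->
  carleman mu z = (Num.sg (complex.Im z))%:C * cmeas_integral mu setT (half_line_exp z).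
Proof.
move=> z0.
pose E (t : R) := cexp ('i%C * t%:C * z).
have E0 : E 0 = 1 by rewrite /E mulr0 mul0r cexp0.
have mE : Cmeasurable (setT : set (measurableTypeR R)) E.
  apply: Cmeasurable_exp; apply: CmeasurableM; last exact: Cmeasurable_cst.
  apply: CmeasurableM; first exact: Cmeasurable_cst.
  by apply: CmeasurableR; exact: measurable_id.
have H0 : half_line_exp z 0 = 2^-1.
  rewrite /half_line_exp mul0r ltxx eqxx.
  by rewrite fmorphV/= rmorph_nat.
have bH := Cbounded_half_line_exp z.
have bE (A : set (measurableTypeR R)) : (forall t, A t -> 0 <= t * complex.Im z) -> Cbounded A E.
  move=> Az; case: mE => [m1 m2]; split.
    by split; exact: measurable_funTS.
  by exists 1 => t /Az; exact: normc_exp_half_line.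
rewrite /carleman; case: ifPn => [zgt0|]; last rewrite -leNgt => zle0.
  rewrite gtr0_sg// mul1r /carleman_pos.
  have -> : `[0, +oo[%classic = [set 0] `|` `]0, +oo[%classic :> set R.
    by rewrite (@setU1itv _ R +oo%O 0 false).
  apply: (@cmeas_integral_halve_atom0 mu `]0, +oo[%classic `]-oo, 0[%classic) => //.
  - by rewrite /= in_itv/= ltxx.
  - by rewrite /= in_itv/= ltxx.
  - apply/seteqP; split => // x [] /=; rewrite !in_itv/= andbT => x0.
    by rewrite ltNge ltW.
  - apply/seteqP; split => // x _ /=; rewrite !in_itv/= andbT.
    by have [|/ltW|->] := ltgtP x 0; [right|left; right|left; left].
  - apply: bE => t /= [->|]; first by rewrite mul0r.
    by rewrite in_itv/= andbT => t0; rewrite mulr_ge0// ltW.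
  - by move=> t; rewrite inE/= in_itv/= andbT => t0; rewrite /half_line_exp mulr_gt0.
  - move=> t; rewrite inE/= in_itv/= => t0; rewrite /half_line_exp ltNge.
    by rewrite nmulr_rle0// ltW//= lt_eqF.
have {zle0}zlt0 : complex.Im z < 0 by rewrite lt_neqAle z0.
rewrite ltr0_sg// rmorphN1 mulN1r /carleman_neg; congr (- _).
have -> : `]-oo, 0]%classic = [set 0] `|` `]-oo, 0[%classic :> set R.
  by rewrite setUC (@setUitv1 _ R -oo%O 0 true).
apply: (@cmeas_integral_halve_atom0 mu `]-oo, 0[%classic `]0, +oo[%classic) => //.
- by rewrite /= in_itv/= ltxx.
- by rewrite /= in_itv/= ltxx.
- apply/seteqP; split => // x [] /=; rewrite !in_itv/= andbT => x0.
  by rewrite ltNge ltW.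
- apply/seteqP; split => // x _ /=; rewrite !in_itv/= andbT.
  by have [| |->] := ltgtP x 0; [left; right|right|left; left].
- apply: bE => t /= [->|]; first by rewrite mul0r.
  by rewrite in_itv/= => t0; rewrite mulr_le0// ltW.
- by move=> t; rewrite inE/= in_itv/= => t0; rewrite /half_line_exp nmulr_rgt0// zlt0.
- move=> t; rewrite inE/= in_itv/= andbT => t0; rewrite /half_line_exp ltNge.
  by rewrite pmulr_rle0// ltW//= gt_eqF.
Qed.

End carleman_transform.

Unset Implicit Arguments.

Theorem mainTheorem5 (R : realType)
    (mu : complex_measure (measurableTypeR R) R) (z : R[i])
    (hz : complex.Im z != 0) :
  VP_exists (fun lambda : R => fourier mu lambda / (lambda%:C + z)) /\
  'i%C * ((Num.sqrt (2 * pi))^-1)%:C *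
    VP_integral (fun lambda : R => fourier mu lambda / (lambda%:C + z))
  = carleman mu z.
Proof.
have [ex ->] := VP_cvgP (VP_cvg_fourier hz mu); split; first exact: ex.
rewrite /limit_kernel cmeas_integralZl//; last exact: Cbounded_half_line_exp.
rewrite carlemanE// !mulrA; congr (_ * _).
have pi2 : 0 <= 2 * pi :> R by rewrite mulr_ge0// pi_ge0.
have e : (Num.sqrt (2 * pi))^-1 ^+ 2 = (2 * pi)^-1 :> R by rewrite exprVn sqr_sqrtr.
(* The integrals already agree; only constants remain. The factor [1 / sqrt(2 pi)] occurs twice, in
   the statement and in the Fourier transform, and cancels the [2 pi] of the kernel, while
   [- i^2 = 1] leaves the sign of [Im z]. *)
transitivity (- ('i%C ^+ 2) * ((Num.sqrt (2 * pi))^-1 ^+ 2 * (2 * pi * Num.sg (complex.Im z)))%:C).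
  by rewrite rmorphN !rmorphM/=; ring.
rewrite sqr_i opprK mul1r e mulrA mulVf ?mul1r//.
by rewrite mulf_neq0// gt_eqF// pi_gt0.
Qed.
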